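(* Let $\phi\colon\mathcal{E}(\mathbb{C}^2)\to\mathcal{E}(\mathbb{C}^2)$ be a bijective map such that for all $A,B\in\mathcal{E}(\mathbb{C}^2)$ $$A\le B\iff\phi(A)\le\phi(B)\qquad\text{and}\qquad A\sim B\iff\phi(A)\sim\phi(B).$$ Then $\phi$ is a standard automorphism of $\mathcal{E}(\mathbb{C}^2)$, i.e. there exists a unitary or antiunitary operator $U\colon\mathbb{C}^2\to\mathbb{C}^2$ such that $\phi(A)=UAU^*$ for all $A\in\mathcal{E}(\mathbb{C}^2)$. Conversely, every standard automorphism of $\mathcal{E}(\mathbb{C}^2)$ satisfies the two displayed equivalences for all $A,B\in\mathcal{E}(\mathbb{C}^2)$.
   Context: For a complex Hilbert space $H$, an effect is a bounded self-adjoint operator $A$ on $H$ with $0\le A\le I$; $\mathcal{E}(H)$ is the set of all effects. $A\le B$ means $\langle Ax,x\rangle\le\langle Bx,x\rangle$ for all $x\in H$. Two effects $A,B\in\mathcal{E}(H)$ are coexistent, written $A\sim B$, if there are $E,F,G\in\mathcal{E}(H)$ with $A=E+G$, $B=F+G$ and $E+F+G\in\mathcal{E}(H)$. *)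

(* Defs.v *)
From HB Require Import structures.
From mathcomp Require Import all_boot all_order all_algebra.
From mathcomp Require Import complex.
From mathcomp Require Import boolp classical_sets reals.

Set Implicit Arguments.
Unset Strict Implicit.
Unset Printing Implicit Defensive.

Import Order.TTheory GRing.Theory Num.Theory.
Local Open Scope classical_set_scope.
Local Open Scope ring_scope.

Section Effects.
Variables (R : realType) (n : nat).
Local Notation C := (R[i]%C).

(* Operators on C^n are matrices acting on column vectors by x |-> A *m x;
   dotmx is the library's inner product of row vectors, linear in its first
   argument. *)
Definition inner (x y : 'cV[C]_n) : C := dotmx x^T y^T.

(* The order of C is partial: x <= y means that y - x is a nonnegative real.
   Both sides below are real when A and B are self-adjoint. *)
Definition le_op (A B : 'M[C]_n) : Prop :=
  forall x : 'cV[C]_n, inner (A *m x) x <= inner (B *m x) x.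

Definition effects : set 'M[C]_n :=
  [set A | A \is hermsymmx /\ le_op 0 A /\ le_op A 1%:M].

(* A set coerces to the subtype of its elements. *)
Definition effect : Type := effects.

Definition effect_op (A : effect) : 'M[C]_n := val A.

Definition effect_le (A B : effect) : Prop := le_op (effect_op A) (effect_op B).

Definition coexistent (A B : effect) : Prop :=
  exists E F G : effect,
    [/\ effect_op A = effect_op E + effect_op G,
        effect_op B = effect_op F + effect_op G &
        effects (effect_op E + effect_op F + effect_op G)].

(* In the next two definitions Us is the adjoint of U, which the displayed
   identity determines uniquely. Antiunitary operators are not given by
   matrices, so both kinds are maps on column vectors. *)
Definition unitary_op (U Us : 'cV[C]_n -> 'cV[C]_n) : Prop :=
  [/\ linear U,
      forall x y, inner (U x) y = inner x (Us y),
      cancel U Us & cancel Us U].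

Definition antiunitary_op (U Us : 'cV[C]_n -> 'cV[C]_n) : Prop :=
  [/\ forall (a : C) (x y : 'cV[C]_n), U (a *: x + y) = a^* *: U x + U y,
      forall x y, inner (U x) y = (inner x (Us y))^*,
      cancel U Us & cancel Us U].

Definition standard_automorphism (phi : effect -> effect) : Prop :=
  exists U Us : 'cV[C]_n -> 'cV[C]_n,
    (unitary_op U Us \/ antiunitary_op U Us) /\
    forall (A : effect) (x : 'cV[C]_n),
      effect_op (phi A) *m x = U (effect_op A *m Us x).

End Effects.

(* Main.v *)
Require Import Defs.
From HB Require Import structures.
From mathcomp Require Import all_boot all_order all_algebra.
From mathcomp Require Import complex ring lra.
From mathcomp Require Import boolp classical_sets reals.

Set Implicit Arguments.
Unset Strict Implicit.
Unset Printing Implicit Defensive.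
Import Order.TTheory GRing.Theory Num.Theory.
Local Open Scope ring_scope.

(** Hermitian 2 x 2 matrices are written w + v.sigma, with w real, v in R^3 and
    sigma the Pauli matrices.  Positivity becomes |v| <= w, so the operator
    order is the order of the Lorentz cone of R^4.  Every effect has a spectral
    form a P_u + b P_(-u), where a, b are its eigenvalues in [0,1], u is a unit
    vector and P_u = (1 + u.sigma) / 2 is the rank-one projection of Bloch
    vector u; here it is [spec a b u].

    Let phi preserve order and coexistence in both directions.  The positive
    multiples of rank-one projections are the nonzero effects with a totally
    ordered set of effects below them, and the projections are the maximal ones
    ([max_chainlikeP]); hence phi (P_u) = P_(tau u) for a map tau of the unit
    sphere.  Coexistence with P_u means commuting with P_u ([coexist_proj]), so
    phi sends the effects diagonal along u to effects diagonal along tau u, and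
    the scalar effects, which commute with every projection, to scalar effects.
    Write phi (t I) = g t I.  Comparing effects with scalars and with multiples
    of projections then gives
      phi (spec a b u) = spec (g a) (g b) (tau u):
    all that remains unknown is the bijection g of [0,1] and the map tau.

    Let p = tr (P_u P_v).  The largest t with t P_u <= spec a b v is the
    weighted harmonic mean of a and b, 1/t = p/a + (1-p)/b
    ([le_rank1_hmean]), and phi must carry it to the corresponding mean of g a
    and g b with weight p' = tr (P_(tau u) P_(tau v)).  With the coordinate
    x = 1/t - 1 on eigenvalues, g becomes an increasing map k of [0,+oo) with
    k 0 = 0 and
      k (p x + (1-p) y) = p' k x + (1-p') k y.
    Setting x or y to 0 shows that k is additive, so k x = c x with c > 0, and
    then p' = p: tau preserves scalar products.

    The order leaves c free; coexistence fixes it.  Two multiples of different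
    rank-one projections coexist if and only if their sum is an effect, which in
    the coordinate x reads p <= x y ([coexist_odds]).  Applying phi turns this
    into p <= c^2 x y, so c = 1 and g is the identity ([symmetry_rotation]).

    Finally tau sends the three axes to an orthonormal frame, and it is the
    rotation or the reflection determined by that frame.  From an eigenvector q
    of the Pauli matrix of tau axis3, the vectors q and (Pauli matrix of
    tau axis1) q form the columns of a unitary matrix V ([pauli_frame]); then
    phi A = V A V^* if the frame is positively oriented and phi A is V times the
    entrywise conjugate of A times V^* if not, the antiunitary case
    ([rotation_standard]).

    The converse holds in every dimension: conjugation by a unitary or
    antiunitary operator is additive on effects and preserves the order, and
    conjugation by its adjoint is the inverse
    ([standard_automorphism_symmetry]). *)

(** * Monotone additive functions *)

(** If m <= n x < m + 1 then both k (n x) and (k 1) (n x) lie in the interval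
    from m (k 1) to (m + 1) (k 1), so n |k x - k 1 x| is bounded independently of n. *)
Lemma additive_mono_linear (R : realType) (k : R -> R) :
  (forall x y, 0 <= x -> x <= y -> k x <= k y) ->
  (forall x y, 0 <= x -> 0 <= y -> k (x + y) = k x + k y) ->
  forall x, 0 <= x -> k x = k 1 * x.
Proof.
move=> mono add.
have k0 : k 0 = 0 by have := add 0 0 (lexx _) (lexx _); rewrite addr0; lra.
have k1 : 0 <= k 1 by rewrite -k0; apply: mono; rewrite ?lexx ?ler01.
have kM x n : 0 <= x -> k (n%:R * x) = n%:R * k x.
  move=> x0; elim: n => [|n IHn]; first by rewrite !mul0r k0.
  by rewrite -addn1 natrD !mulrDl !mul1r add ?IHn // mulr_ge0 // ler0n.
have kn n : k n%:R = n%:R * k 1 by rewrite -{1}[n%:R]mulr1 kM // ler01.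
move=> x x0.
(* The natural number m below is the integral part of n x. *)
have bound n : (0 < n)%N -> n%:R * `|k x - k 1 * x| <= k 1.
  move=> n0; have n0' : 0 < n%:R :> R by rewrite ltr0n.
  have nx0 : 0 <= n%:R * x by rewrite mulr_ge0 // ltW.
  have /andP[h1 h2] := truncn_itv nx0.
  set m := Num.truncn _ in h1 h2.
  have h3 : m%:R * k 1 <= n%:R * k x.
    by rewrite -kn -kM //; apply: mono => //; exact: ler0n.
  have h4 : n%:R * k x <= (m%:R + 1) * k 1.
    by rewrite -natr1 in h2; rewrite -kM // natr1 -kn; apply: mono => //; rewrite -natr1 ltW.
  rewrite -{1}(ger0_norm (ltW n0')) -normrM ler_norml mulrBr.
  by rewrite -natr1 in h2; apply/andP; split; nra.
apply/eqP; rewrite -subr_eq0 -normr_le0 leNgt; apply/negP => pos.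
have := @truncnS_gt R (k 1 / `|k x - k 1 * x|).
rewrite ltr_pdivrMr // => h.
by have := bound _ (ltn0Sn (Num.truncn (k 1 / `|k x - k 1 * x|))); lra.
Qed.

(** * Effects as operators *)

Section Effects.
Variables (R : realType) (n : nat).
Local Notation C := (R[i]%C).

Definition mk_effect (M : 'M[C]_n) (h : effects M) : effect R n :=
  exist (fun M : 'M[C]_n => is_true (M \in @effects R n)) M (mem_set h).

Lemma effect_opP (A : effect R n) : effects (effect_op A).
Proof. exact: set_mem (valP A). Qed.

Lemma effect_op_inj (A B : effect R n) : effect_op A = effect_op B -> A = B.
Proof. exact: val_inj. Qed.

Lemma effect_le_refl (A : effect R n) : effect_le A A.
Proof. by move=> x. Qed.

Lemma innerDl (x y z : 'cV[C]_n) : inner (x + y) z = inner x z + inner y z.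
Proof. by rewrite /inner !dotmxE linearD mulmxDl mxE. Qed.

Lemma le_opDl (A B D : 'M[C]_n) : le_op A B <-> le_op (D + A) (D + B).
Proof.
by split=> h x; have := h x; rewrite !mulmxDl !innerDl lerD2l.
Qed.

End Effects.

(** * Bloch coordinates of Hermitian 2 x 2 matrices *)

Section Bloch.
Variable R : realType.
Local Notation C := (R[i]%C).
Local Notation vec := 'rV[R]_3.
Implicit Types (u v : vec) (w : R).

Definition dot u v : R := u 0 0 * v 0 0 + u 0 1 * v 0 1 + u 0 2 * v 0 2.
(** The matrix w + v.sigma, for sigma the vector of Pauli matrices. *)
Definition bloch w v : 'M[C]_2 :=
  \matrix_(i, j) if i == 0 then if j == 0 then Complex (w + v 0 2) 0
                                else Complex (v 0 0) (- v 0 1)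
                 else if j == 0 then Complex (v 0 0) (v 0 1)
                      else Complex (w - v 0 2) 0.
(** The closed forward light cone, without square roots. *)
Definition cone w v : Prop := 0 <= w /\ dot v v <= w ^+ 2.

Lemma vecP u v : u 0 0 = v 0 0 -> u 0 1 = v 0 1 -> u 0 2 = v 0 2 -> u = v.
Proof.
move=> e0 e1 e2; apply/rowP => -[[|[|[|//]]] i].
- by rewrite (_ : Ordinal i = 0) //; apply: val_inj.
- by rewrite (_ : Ordinal i = 1) //; apply: val_inj.
- by rewrite (_ : Ordinal i = 2) //; apply: val_inj.
Qed.

Lemma mx2P (T : Type) (M N : 'M[T]_2) :
  M 0 0 = N 0 0 -> M 0 1 = N 0 1 -> M 1 0 = N 1 0 -> M 1 1 = N 1 1 -> M = N.
Proof.
move=> e0 e1 e2 e3; apply/matrixP.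
have H (i : 'I_2) : i = 0 \/ i = 1.
  by case: i => [[|[|//]] hi]; [left|right]; exact: val_inj.
by move=> i j; case: (H i) => ->; case: (H j) => ->.
Qed.

Lemma sum2E (V : nmodType) (F : 'I_2 -> V) : \sum_i F i = F 0 + F 1.
Proof.
rewrite !big_ord_recl big_ord0 addr0.
by congr (F _ + F _); apply: val_inj.
Qed.

Lemma innerE (x y : 'cV[C]_2) :
  inner x y = x 0 0 * (y 0 0)^* + x 1 0 * (y 1 0)^*.
Proof. by rewrite /inner dotmxE !mxE sum2E !mxE. Qed.

(** The expectation is w |n| + v.n for the vector n read off on the right, the
    (unnormalized) Bloch vector of x, whose length is the squared norm of x. *)
Lemma inner_bloch w v (x : 'cV[C]_2) (a b c d : R) :
  x 0 0 = Complex a b -> x 1 0 = Complex c d ->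
  inner (bloch w v *m x) x = Complex
   (w * (a^+2+b^+2+c^+2+d^+2) + v 0 2 * (a^+2+b^+2-c^+2-d^+2)
     + v 0 0 * (2 * (a*c+b*d)) + v 0 1 * (2 * (a * d - b * c))) 0.
Proof.
move=> ex ey; rewrite innerE !mxE !sum2E !mxE /= ex ey.
by apply/eqP; rewrite eq_complex /=; apply/andP; split; apply/eqP; ring.
Qed.

Lemma bloch0 : bloch 0 0 = 0.
Proof. by apply: mx2P; rewrite !mxE /= ?oppr0 ?addr0 ?subr0. Qed.

Lemma bloch1 : bloch 1 0 = 1%:M.
Proof. by apply: mx2P; rewrite !mxE /= ?oppr0 ?addr0 ?subr0. Qed.

Lemma blochD w v w' v' : bloch w v + bloch w' v' = bloch (w + w') (v + v').
Proof.
by apply: mx2P; rewrite !mxE /=; apply/eqP; rewrite eq_complex /=;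
  apply/andP; split; apply/eqP; ring.
Qed.

Lemma bloch_inj w v w' v' : bloch w v = bloch w' v' -> w = w' /\ v = v'.
Proof.
move/matrixP => e; have := e 0 0; have := e 1 1; have := e 0 1.
rewrite !mxE /= => -[e1 e2] [e3] [e4].
have ew : w = w' by lra.
by split=> //; apply: vecP => //; lra.
Qed.

Lemma Cauchy_Schwarz u v : dot u v ^+ 2 <= dot u u * dot v v.
Proof.
rewrite -subr_ge0 /dot.
have -> (a b c d e f : R) : (a * a + b * b + c * c) * (d * d + e * e + f * f) -
   (a * d + b * e + c * f) ^+ 2 =
   (a * e - b * d) ^+ 2 + (b * f - c * e) ^+ 2 + (c * d - a * f) ^+ 2 by ring.
by rewrite !addr_ge0 ?sqr_ge0.
Qed.

Lemma dot_ge0 u : 0 <= dot u u.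
Proof. by rewrite /dot -!expr2 !addr_ge0 ?sqr_ge0. Qed.

Lemma dot_eq0 u : dot u u = 0 -> u = 0.
Proof.
rewrite /dot => e; have := sqr_ge0 (u 0 0); have := sqr_ge0 (u 0 1).
have := sqr_ge0 (u 0 2) => h2 h1 h0.
have z (x : R) : x ^+ 2 = 0 -> x = 0 by move/eqP; rewrite sqrf_eq0 => /eqP.
by apply: vecP; rewrite !mxE; apply: z; lra.
Qed.

(** In the notation of [inner_bloch], positivity of w + v.sigma says that
    w |n| + v.n >= 0 for all n in R^3.  By the Cauchy-Schwarz inequality this
    follows from |v| <= w, and n = - v gives the converse. *)
Lemma le_op_bloch w v w' v' :
  le_op (bloch w v) (bloch w' v') <-> cone (w' - w) (v' - v).
Proof.
split; last first.
  move=> [h0 h1] x.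
  case ex : (x 0 0) => [a b]; case ey : (x 1 0) => [c d].
  rewrite (inner_bloch _ _ ex ey) (inner_bloch _ _ ex ey) lecE eqxx /=.
  (* The Bloch vector of x, and the squared norm of x. *)
  pose n : vec := \row_i if i == 0 then 2 * (a*c+b*d) else
     if i == 1 then 2 * (a * d - b * c) else a^+2+b^+2-c^+2-d^+2.
  pose N := a^+2+b^+2+c^+2+d^+2.
  have N0 : 0 <= N by rewrite !addr_ge0 ?sqr_ge0.
  have nN : dot n n = N ^+ 2 by rewrite /dot !mxE /= /N; ring.
  have := Cauchy_Schwarz (v' - v) n; rewrite nN => CS.
  suff : - ((w' - w) * N) <= dot (v' - v) n.
    by rewrite /dot !mxE /= /N; lra.
  have g0 : 0 <= (w' - w) * N by rewrite mulr_ge0.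
  have : dot (v' - v) n ^+ 2 <= ((w' - w) * N) ^+ 2.
    by apply: le_trans CS _; rewrite exprMn ler_wpM2r ?sqr_ge0.
  rewrite -ler_sqrt ?sqr_ge0 // !sqrtr_sqr (ger0_norm g0) ler_norml.
  by case/andP.
move=> h.
have H (a b c d : R) : 0 <= (w' - w) * (a^+2+b^+2+c^+2+d^+2) +
    (v' - v) 0 2 * (a^+2+b^+2-c^+2-d^+2)
     + (v' - v) 0 0 * (2 * (a*c+b*d)) + (v' - v) 0 1 * (2 * (a * d - b * c)).
  pose x : 'cV[C]_2 := \col_i if i == 0 then Complex a b else Complex c d.
  have ex : x 0 0 = Complex a b by rewrite mxE.
  have ey : x 1 0 = Complex c d by rewrite mxE.
  have := h x; rewrite (inner_bloch _ _ ex ey) (inner_bloch _ _ ex ey) lecE.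
  by rewrite eqxx /= !mxE; lra.
move: (w' - w) (v' - v) H => {h w' v'} {}w {}v H.
pose r := Num.sqrt (dot v v).
have r0 : 0 <= r by rewrite sqrtr_ge0.
have rv : r ^+ 2 = dot v v by rewrite sqr_sqrtr ?dot_ge0.
suff rw : r <= w by split; [exact: le_trans rw | rewrite -rv ler_sqr ?nnegrE ?(le_trans r0)].
(* The expectation in an eigenvector of v.sigma for the eigenvalue - r is a
   positive multiple of w - r.  The eigenvector (r - v3, - v1 - i v2) vanishes when
   v3 = r; then (0, 1) is one. *)
have [e | ne] := eqVneq r (v 0 2).
  by have := H 0 0 1 0; rewrite e; lra.
have zr : v 0 2 < r.
  rewrite lt_neqAle eq_sym ne /=.
  have : (v 0 2) ^+ 2 <= r ^+ 2.
    by rewrite rv /dot; have := sqr_ge0 (v 0 0); have := sqr_ge0 (v 0 1); lra.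
  rewrite -ler_sqrt ?sqr_ge0 // !sqrtr_sqr (ger0_norm r0) ler_norml.
  by case/andP.
have := H (r - v 0 2) 0 (- v 0 0) (- v 0 1).
have e : dot v v = r ^+ 2 by [].
rewrite /dot in e.
set z := v 0 2 in zr e *; set x := v 0 0 in e *; set y := v 0 1 in e *.
have e' : x ^+ 2 + y ^+ 2 = r ^+ 2 - z ^+ 2 by lra.
have -> : w * ((r - z) ^+ 2 + 0 ^+ 2 + (- x) ^+ 2 + (- y) ^+ 2)
  + z * ((r - z) ^+ 2 + 0 ^+ 2 - (- x) ^+ 2 - (- y) ^+ 2) +
  x * (2 * ((r - z) * - x + 0 * - y)) + y * (2 * ((r - z) * - y - 0 * - x))
  = w * ((r - z) ^+ 2 + (x ^+ 2 + y ^+ 2)) + z * ((r - z) ^+ 2 - (x ^+ 2 + y ^+ 2))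
  - 2 * (r - z) * (x ^+ 2 + y ^+ 2) by ring.
rewrite e'.
have -> : w * ((r - z) ^+ 2 + (r ^+ 2 - z ^+ 2)) +
  z * ((r - z) ^+ 2 - (r ^+ 2 - z ^+ 2)) - 2 * (r - z) * (r ^+ 2 - z ^+ 2)
   = (w - r) * (2 * r * (r - z)) by ring.
have rp : 0 < r.
  rewrite lt_neqAle r0 andbT; apply/eqP => r00; move: zr e'; rewrite -r00 => zr e'.
  have := sqr_ge0 x; have := sqr_ge0 y; nra.
by rewrite pmulr_lge0 ?subr_ge0 // mulr_gt0 ?subr_gt0 // mulr_gt0.
Qed.

Lemma bloch_herm w v : bloch w v \is hermsymmx.
Proof.
apply/is_hermitianmxP; rewrite expr0 scale1r.
have conjE (a b : R) : (Complex a b)^* = Complex a (- b) by [].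
by apply: mx2P; rewrite !mxE /= conjE ?oppr0 ?opprK.
Qed.

Lemma herm_bloch (M : 'M[C]_2) : M \is hermsymmx -> exists w v, M = bloch w v.
Proof.
move/is_hermitianmxP; rewrite expr0 scale1r => /matrixP e.
have := e 0 0; have := e 0 1; have := e 1 0; have := e 1 1; rewrite !mxE.
case e00 : (M 0 0) => [a b]; case e11 : (M 1 1) => [c d].
case e01 : (M 0 1) => [p q]; case e10 : (M 1 0) => [r s] /=.
move=> -[hd] [hr hs] _ [hb].
exists ((a + c) / 2), (\row_i if i == 0 then p else if i == 1 then - q else (a - c) / 2).
by apply: mx2P; rewrite !mxE /= ?e00 ?e01 ?e10 ?e11; apply/eqP;
  rewrite eq_complex /=; apply/andP; split; apply/eqP; lra.
Qed.

Lemma dotNN u : dot (- u) (- u) = dot u u.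
Proof. by rewrite /dot !mxE; ring. Qed.

Lemma effects_bloch w v : effects (bloch w v) <-> cone w v /\ cone (1 - w) v.
Proof.
rewrite /effects /= -bloch0 -bloch1 !le_op_bloch !subr0 sub0r.
rewrite /cone !dotNN.
by split => [[_]|?] //; split=> //; exact: bloch_herm.
Qed.

Definition unit_vec u := dot u u = 1.
Definition in01 (t : R) : Prop := 0 <= t /\ t <= 1.
(** The matrix a P_u + b P_(-u), for u a unit vector. *)
Definition spec_mx (a b : R) u := bloch ((a + b) / 2) (((a - b) / 2) *: u).

Lemma spec_cone (a b : R) u : unit_vec u ->
  cone ((a + b) / 2) (((a - b) / 2) *: u) <-> 0 <= a /\ 0 <= b.
Proof.
move=> hu; have e : dot (((a - b) / 2) *: u) (((a - b) / 2) *: u) = ((a - b) / 2) ^+ 2.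
  by rewrite -[RHS]mulr1 -hu /dot !mxE; ring.
rewrite /cone e; split => [[h1 h2]|[h1 h2]].
  have h : 0 <= a * b by nra.
  by split; nra.
by split; nra.
Qed.

Lemma spec_mx_effects a b u : in01 a -> in01 b -> unit_vec u ->
  effects (spec_mx a b u).
Proof.
move=> [a0 a1] [b0 b1] hu; apply/effects_bloch; split.
  exact/spec_cone.
have [_ /(_ _)] := spec_cone (1 - b) (1 - a) hu.
have -> : (1 - b - (1 - a)) / 2 = (a - b) / 2 by lra.
have -> : (1 - b + (1 - a)) / 2 = 1 - (a + b) / 2 by lra.
by apply; split; lra.
Qed.

Definition axis1 : vec := \row_i if i == 0 then 1 else 0.
Definition axis2 : vec := \row_i if i == 1 then 1 else 0.
Definition axis3 : vec := \row_i if i == 2 then 1 else 0.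

Lemma dot_axis1 v : dot v axis1 = v 0 0.
Proof. by rewrite /dot !mxE /=; ring. Qed.

Lemma dot_axis2 v : dot v axis2 = v 0 1.
Proof. by rewrite /dot !mxE /=; ring. Qed.

Lemma dot_axis3 v : dot v axis3 = v 0 2.
Proof. by rewrite /dot !mxE /=; ring. Qed.

Lemma unit_axis1 : unit_vec axis1.
Proof. by rewrite /unit_vec dot_axis1 mxE. Qed.

Lemma unit_axis2 : unit_vec axis2.
Proof. by rewrite /unit_vec dot_axis2 mxE. Qed.

Lemma unit_axis3 : unit_vec axis3.
Proof. by rewrite /unit_vec dot_axis3 mxE. Qed.

Lemma polar v : exists r u, [/\ 0 <= r, unit_vec u & v = r *: u].
Proof.
pose r := Num.sqrt (dot v v).
have r0 : 0 <= r by rewrite sqrtr_ge0.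
have rv : r ^+ 2 = dot v v by rewrite sqr_sqrtr ?dot_ge0.
have [z|nz] := eqVneq r 0.
  exists 0, axis3; split=> //; first exact: unit_axis3.
  by rewrite scale0r; apply: dot_eq0; rewrite -rv z expr0n.
exists r, (r^-1 *: v); split=> //; last by rewrite scalerA divff // scale1r.
rewrite /unit_vec; have -> : dot (r^-1 *: v) (r^-1 *: v) = r^-1 ^+ 2 * dot v v.
  by rewrite /dot !mxE; ring.
by rewrite -rv -exprMn mulVf // expr1n.
Qed.

Lemma effects_spec M : effects M -> exists a b u,
  [/\ in01 a, in01 b, unit_vec u & M = spec_mx a b u].
Proof.
move=> hM; have [w [v e]] := herm_bloch hM.1.
case: (polar v) => r [u [r0 hu ev]].
have eM : M = spec_mx (w + r) (w - r) u.
  by rewrite e ev /spec_mx; congr (bloch _ (_ *: _)); lra.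
exists (w + r), (w - r), u.
move: hM; rewrite eM /spec_mx => /effects_bloch [/(spec_cone _ _ hu) [h1 h2]].
have -> : 1 - (w + r + (w - r)) / 2 = ((1 - w + r) + (1 - w - r)) / 2 by lra.
have -> : (w + r - (w - r)) / 2 = ((1 - w + r) - (1 - w - r)) / 2 by lra.
by move=> /(spec_cone _ _ hu) [h3 h4]; split=> //; split; lra.
Qed.

Lemma in01_0 : in01 0. Proof. by split; rewrite ?lexx ?ler01. Qed.
Lemma in01_1 : in01 1. Proof. by split; rewrite ?lexx ?ler01. Qed.
Hint Resolve in01_0 in01_1 unit_axis3 : core.

Definition zero_effect : effect R 2 := mk_effect (spec_mx_effects in01_0 in01_0 unit_axis3).
End Bloch.

(** * Order and coexistence in spectral form *)

(** Off the intended domain (eigenvalues in [0,1] and a unit vector) the value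
    is the zero effect; a total function keeps proofs of these conditions out of
    the terms. *)
HB.lock Definition spec (R : realType) (a b : R) (u : 'rV[R]_3) : effect R 2 :=
  insubd (zero_effect R) (spec_mx a b u).

Section SpectralEffects.
Variable R : realType.
Local Notation C := (R[i]%C).
Local Notation vec := 'rV[R]_3.
Implicit Types (a b c d s t w : R) (u v : vec).
Hint Resolve in01_0 in01_1 unit_axis3 : core.

Lemma effect_op_spec a b u : in01 a -> in01 b -> unit_vec u ->
  effect_op (spec a b u) = spec_mx a b u.
Proof.
move=> ha hb hu; rewrite /effect_op spec.unlock insubdK //.
by apply: mem_set; exact: spec_mx_effects.
Qed.

Lemma specP (A : effect R 2) : exists a b u, [/\ in01 a, in01 b, unit_vec u & A = spec a b u].
Proof.
have [a [b [u [ha hb hu e]]]] := effects_spec (effect_opP A).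
exists a, b, u; split=> //; apply: effect_op_inj.
by rewrite effect_op_spec.
Qed.

Lemma spec_mxN a b u : spec_mx a b (- u) = spec_mx b a u.
Proof. by rewrite /spec_mx scalerN -scaleNr; congr (bloch _ (_ *: _)); lra. Qed.

Lemma specN a b u : spec a b (- u) = spec b a u.
Proof. by rewrite spec.unlock spec_mxN. Qed.

Lemma spec_scalar a u v : spec a a u = spec a a v.
Proof. by rewrite spec.unlock /spec_mx subrr mul0r !scale0r. Qed.

Lemma le_spec_same a b c d u : in01 a -> in01 b -> in01 c -> in01 d ->
  unit_vec u -> effect_le (spec a b u) (spec c d u) <-> a <= c /\ b <= d.
Proof.
move=> ha hb hc hd hu; rewrite /effect_le !effect_op_spec // le_op_bloch -scalerBl.
have -> : (c + d) / 2 - (a + b) / 2 = ((c - a) + (d - b)) / 2 by lra.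
have -> : (c - d) / 2 - (a - b) / 2 = ((c - a) - (d - b)) / 2 by lra.
by rewrite spec_cone // !subr_ge0.
Qed.

Lemma spec_le a b c d u : in01 a -> in01 b -> in01 c -> in01 d ->
  unit_vec u -> a <= c -> b <= d -> effect_le (spec a b u) (spec c d u).
Proof.
by move=> ha hb hc hd hu h1 h2; apply: (le_spec_same ha hb hc hd hu).2; split.
Qed.

Lemma spec_inj a b c d u : in01 a -> in01 b -> in01 c -> in01 d ->
  unit_vec u -> spec a b u = spec c d u -> a = c /\ b = d.
Proof.
move=> ha hb hc hd hu e.
have : effect_le (spec a b u) (spec c d u) by rewrite e; exact: effect_le_refl.
move=> /(le_spec_same ha hb hc hd hu) [h3 h4].
have : effect_le (spec c d u) (spec a b u) by rewrite e; exact: effect_le_refl.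
move=> /(le_spec_same hc hd ha hb hu) [h1 h2].
by split; apply/eqP; rewrite eq_le ?h1 ?h2 ?h3 ?h4.
Qed.

Lemma spec_rank1_inj s t u v : in01 s -> in01 t -> unit_vec u -> unit_vec v ->
  0 < s -> spec s 0 u = spec t 0 v -> u = v.
Proof.
move=> hs ht hu hv s0 /(congr1 (@effect_op R 2)).
rewrite !effect_op_spec // => /bloch_inj [e1].
have -> : t = s by lra.
by apply: scalerI; apply: lt0r_neq0; lra.
Qed.

(** The transition probability tr (P_u P_v) of two pure states. *)
Definition overlap u v : R := (1 + dot u v) / 2.

(** The two conditions say that the difference of the two effects has
    nonnegative trace and nonnegative determinant. *)
Lemma le_rank1 t a b u v : in01 t -> in01 a -> in01 b -> unit_vec u -> unit_vec v ->
  effect_le (spec t 0 u) (spec a b v) <->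
  t <= a + b /\ t * (a * (1 - overlap u v) + b * overlap u v) <= a * b.
Proof.
move=> ht ha hb hu hv; rewrite /effect_le !effect_op_spec // le_op_bloch.
rewrite /cone /overlap.
have -> : dot (((a - b) / 2) *: v - ((t - 0) / 2) *: u)
          (((a - b) / 2) *: v - ((t - 0) / 2) *: u) =
   ((a - b) / 2) ^+ 2 * dot v v + (t / 2) ^+ 2 * dot u u - (a - b) * t / 2 * dot u v.
  by rewrite /dot !mxE; field.
by rewrite hu hv; split=> -[h1 h2]; split; nra.
Qed.

(** The quantity w - v.u is the expectation of w + v.sigma in the pure state
    of Bloch vector - u. *)
Lemma cone_dot w v u : unit_vec u -> cone w v -> 0 <= w - dot v u.
Proof.
move=> hu [w0 hv]; have := Cauchy_Schwarz v u; rewrite hu mulr1 => h.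
rewrite subr_ge0; have : dot v u ^+ 2 <= w ^+ 2 by apply: le_trans hv.
rewrite -ler_sqrt ?sqr_ge0 // !sqrtr_sqr (ger0_norm w0) ler_norml.
by case/andP.
Qed.

(** The null hyperplane through the ray of (1, u) touches the light cone along
    that ray only. *)
Lemma cone_tangent w v u : unit_vec u -> cone w v -> w - dot v u <= 0 -> v = w *: u.
Proof.
move=> hu [w0 hv] h.
apply/eqP; rewrite -subr_eq0; apply/eqP/dot_eq0/eqP.
rewrite eq_le dot_ge0 andbT.
have -> : dot (v - w *: u) (v - w *: u) = dot v v - 2 * w * dot v u + w ^+ 2 * dot u u.
  by rewrite /dot !mxE; ring.
by rewrite hu; nra.
Qed.

(** An effect below t P_u has expectation zero in the state orthogonal to P_u,
    so [cone_tangent] puts it on the ray of P_u. *)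
Lemma le_rank1_inv (A : effect R 2) t u : in01 t -> unit_vec u ->
  effect_le A (spec t 0 u) -> exists2 s, in01 s & A = spec s 0 u.
Proof.
move=> ht hu; have hA := effect_opP A.
have [w [v e]] := herm_bloch hA.1.
move: hA; rewrite e => /effects_bloch [cA _].
rewrite /effect_le e effect_op_spec // le_op_bloch => cB.
have h1 := cone_dot hu cA; have h2 := cone_dot hu cB.
have e2 : dot ((t - 0) / 2 *: u - v) u = t / 2 * dot u u - dot v u.
  by rewrite /dot !mxE; ring.
rewrite e2 hu in h2.
have ev : v = w *: u by apply: cone_tangent => //; lra.
have hs : in01 (2 * w).
  case: ht => t0 t1; case: cA => w0 _; case: cB => hw _.
  by split; lra.
exists (2 * w) => //; apply: effect_op_inj; rewrite e effect_op_spec // ev.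
by rewrite /spec_mx; congr (bloch _ (_ *: _)); field.
Qed.

Lemma spec_mxD a b c d u : spec_mx a b u + spec_mx c d u = spec_mx (a + c) (b + d) u.
Proof.
by rewrite /spec_mx blochD -scalerDl; congr (bloch _ (_ *: _)); field.
Qed.

Lemma spec_mx_compl a b u : 1%:M - spec_mx a b u = spec_mx (1 - a) (1 - b) u.
Proof.
apply/eqP; rewrite subr_eq spec_mxD !subrK -bloch1 /spec_mx subrr mul0r scale0r.
by apply/eqP; congr bloch; field.
Qed.

(** Coexistence with a projection is commutation.  In a decomposition
    A = E + G, P = F + G one has G <= P and, from E + P <= 1, also E <= 1 - P;
    both G and E are then multiples of rank-one projections along the axis u. *)
Lemma coexist_proj (A : effect R 2) u : unit_vec u ->
  coexistent A (spec 1 0 u) <-> exists a b, [/\ in01 a, in01 b & A = spec a b u].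
Proof.
move=> hu; have hNu : unit_vec (- u) by rewrite /unit_vec dotNN.
have e1 := in01_1 R; have e0 := in01_0 R.
split=> [[E [F [G [eA eP eS]]]] | [a [b [ha hb ->]]]].
  have [g hg eG] : exists2 g, in01 g & G = spec g 0 u.
    apply: (le_rank1_inv e1 hu); rewrite /effect_le eP.
    move/(le_opDl _ _ (effect_op G)): (effect_opP F).2.1.
    by rewrite addr0 addrC.
  have [h hh eE] : exists2 h, in01 h & E = spec h 0 (- u).
    apply: (le_rank1_inv e1 hNu); rewrite /effect_le specN (effect_op_spec e0 e1 hu).
    apply/(le_opDl _ _ (effect_op F + effect_op G)).
    rewrite addrC addrA -eP (effect_op_spec e1 e0 hu) spec_mxD.
    have := eS.2.2; rewrite -[1%:M]bloch1 /spec_mx; congr le_op.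
    by rewrite addr0 add0r subrr mul0r scale0r; congr bloch; field.
  exists g, h; split=> //; apply: effect_op_inj.
  rewrite eA eG eE specN !effect_op_spec // spec_mxD.
  by rewrite add0r addr0.
have hc : in01 (1 - a) by case: ha => h1 h2; split; lra.
exists (spec 0 b u), (spec (1 - a) 0 u), (spec a 0 u).
rewrite !effect_op_spec // !spec_mxD; split.
- by rewrite add0r addr0.
- by rewrite subrK addr0.
- by rewrite add0r subrK !addr0; exact: spec_mx_effects.
Qed.

Lemma in01_compl t : in01 t -> in01 (1 - t).
Proof. by case=> h1 h2; split; lra. Qed.

(** The common part G lies below multiples of two different rank-one
    projections, hence vanishes; what is left is that the sum be an effect. *)
Lemma coexist_rank1 s t u v : in01 s -> in01 t -> unit_vec u -> unit_vec v -> u != v ->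
  coexistent (spec s 0 u) (spec t 0 v) <-> effect_le (spec s 0 u) (spec (1 - t) 1 v).
Proof.
move=> hs ht hu hv uv; have ht' := in01_compl ht.
have e1 := in01_1 R; have e0 := in01_0 R.
rewrite /effect_le (effect_op_spec ht' e1 hv).
have -> : spec_mx (1 - t) 1 v = 1%:M - spec_mx t 0 v by rewrite spec_mx_compl subr0.
split=> [[E [F [G [eA eP eS]]]] | h].
  have [g hg eG] : exists2 g, in01 g & G = spec g 0 u.
    apply: (le_rank1_inv hs hu); rewrite /effect_le eA.
    move/(le_opDl _ _ (effect_op G)): (effect_opP E).2.1.
    by rewrite addr0 addrC.
  have [h hh eG'] : exists2 g, in01 g & G = spec g 0 v.
    apply: (le_rank1_inv ht hv); rewrite /effect_le eP.
    move/(le_opDl _ _ (effect_op G)): (effect_opP F).2.1.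
    by rewrite addr0 addrC.
  have g0 : g = 0.
    apply/eqP; apply: contraT => gn; case/negP: uv; apply/eqP.
    apply: (@spec_rank1_inj g h) => //; last by rewrite -eG.
    by rewrite lt_def gn; case: hg.
  have G0 : effect_op G = 0.
    by rewrite eG g0 effect_op_spec // /spec_mx addr0 subr0 mul0r scale0r bloch0.
  apply/(le_opDl _ _ (spec_mx t 0 v)); rewrite addrC [X in le_op _ X]addrC subrK.
  rewrite eA -(effect_op_spec ht e0 hv) eP.
  by have := eS.2.2; rewrite G0 !addr0.
exists (spec s 0 u), (spec t 0 v), (spec 0 0 u).
have eS : effect_op (spec 0 0 u) = 0.
  by rewrite effect_op_spec // /spec_mx addr0 subr0 mul0r scale0r bloch0.
rewrite eS !addr0; split; [by []|by []|split; [|split]].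
- rewrite (effect_op_spec hs e0 hu) (effect_op_spec ht e0 hv) blochD.
  exact: bloch_herm.
- have h1 := (effect_opP (spec s 0 u)).2.1; have h2 := (effect_opP (spec t 0 v)).2.1.
  move/(le_opDl _ _ (effect_op (spec s 0 u))): h2 => h2 x.
  by apply: le_trans (h1 x) _; have := h2 x; rewrite addr0.
- move/(le_opDl _ _ (spec_mx t 0 v)): h; rewrite addrC [X in le_op _ X]addrC subrK.
  by rewrite (effect_op_spec ht e0 hv).
Qed.

End SpectralEffects.

(** * Order-theoretic description of the rank-one projections *)

Section Symmetry.
Variable R : realType.
Local Notation vec := 'rV[R]_3.
Local Notation eff := (effect R 2).
Implicit Types (u v : vec) (A B D : eff).

Hint Resolve in01_0 in01_1 unit_axis3 : core.

Definition symmetry (phi : eff -> eff) : Prop :=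
  [/\ bijective phi,
      forall A B, effect_le A B <-> effect_le (phi A) (phi B) &
      forall A B, coexistent A B <-> coexistent (phi A) (phi B)].

Lemma symmetry_inv phi : symmetry phi ->
  exists psi, [/\ symmetry psi, cancel phi psi & cancel psi phi].
Proof.
move=> [[psi h1 h2] hle hco]; exists psi; split; [split| |] => [|A B|A B| |].
- by exists phi.
- by have := hle (psi A) (psi B); rewrite (h2 A) (h2 B); exact: iff_sym.
- by have := hco (psi A) (psi B); rewrite (h2 A) (h2 B); exact: iff_sym.
- exact: h1.
- exact: h2.
Qed.

(** Nonzero, with a totally ordered set of effects below.  The definition uses
    the order only, hence is invariant under symmetries. *)
Definition chainlike A : Prop := (exists B, ~ effect_le A B) /\
  forall B D, effect_le B A -> effect_le D A -> effect_le B D \/ effect_le D B.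

Definition max_chainlike A : Prop := chainlike A /\
  forall B, chainlike B -> effect_le A B -> effect_le B A.

Lemma symmetry_chainlike phi A : symmetry phi -> chainlike A -> chainlike (phi A).
Proof.
move=> hphi [[B hB] ch]; case: (hphi) => _ hle _.
have [psi [_ K1 K2]] := symmetry_inv hphi.
split; first by exists (phi B) => /(hle A B).2.
move=> D E; rewrite -(K2 D) -(K2 E) => /(hle _ _).2 hD /(hle _ _).2 hE.
by case: (ch _ _ hD hE) => h; [left|right]; apply: (hle _ _).1.
Qed.

Lemma symmetry_max_chainlike phi A :
  symmetry phi -> max_chainlike A -> max_chainlike (phi A).
Proof.
move=> hphi [hA mA]; case: (hphi) => _ hle _.
have [psi [hpsi K1 K2]] := symmetry_inv hphi.
split; first exact: symmetry_chainlike.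
move=> D /(symmetry_chainlike hpsi) hD; rewrite -(K2 D) => /(hle _ _).2 h.
by apply/(hle _ _).1/mA.
Qed.

Lemma spec0_le u A : unit_vec u -> effect_le (spec 0 0 u) A.
Proof.
move=> hu; have [a [b [v [ha hb hv ->]]]] := specP A.
by rewrite (spec_scalar 0 u v); apply: spec_le => //; [case: ha|case: hb].
Qed.

Lemma unit_vecN u : unit_vec u -> unit_vec (- u).
Proof. by rewrite /unit_vec dotNN. Qed.

(** Below an effect with two positive eigenvalues a and b lie the incomparable
    effects a P_u and b P_(-u). *)
Lemma chainlikeP A :
  chainlike A <-> exists t u, [/\ 0 < t, in01 t, unit_vec u & A = spec t 0 u].
Proof.
split; last first.
  move=> [t [u [t0 ht hu ->]]]; split.
    by exists (spec 0 0 u) => /(le_spec_same ht (in01_0 R) (in01_0 R) (in01_0 R) hu) []; lra.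
  move=> B D /(le_rank1_inv ht hu) [s hs ->] /(le_rank1_inv ht hu) [s' hs' ->].
  by case/orP: (le_total s s') => h; [left|right]; apply: spec_le.
have [a [b [u [ha hb hu ->]]]] := specP A.
have ha' := ha; have hb' := hb; case: ha' => a0 a1; case: hb' => b0 b1.
move=> [[B hB] ch].
have [ea | na] := eqVneq a 0.
  (* The only possibly nonzero eigenvalue is b, along - u. *)
  exists b, (- u); split=> //; [|exact: unit_vecN|by rewrite specN ea].
  rewrite lt_def b0 andbT; apply/eqP => eb; apply: hB.
  by rewrite ea eb; exact: spec0_le.
have {na}ap : 0 < a by rewrite lt_def na.
have [eb | nb] := eqVneq b 0; first by exists a, u; split=> //; rewrite eb.
have {nb}bp : 0 < b by rewrite lt_def nb.
have h1 : effect_le (spec a 0 u) (spec a b u) by apply: spec_le.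
have h2 : effect_le (spec 0 b u) (spec a b u) by apply: spec_le.
have z := in01_0 R.
have [h|h] := ch _ _ h1 h2.
  by have [] := (le_spec_same ha z z hb hu).1 h; lra.
by have [] := (le_spec_same z hb ha z hu).1 h; lra.
Qed.

Lemma max_chainlikeP A : max_chainlike A <-> exists2 u, unit_vec u & A = spec 1 0 u.
Proof.
split.
  move=> [/chainlikeP [t [u [t0 ht hu ->]]] mx]; exists u => //.
  have [_ t1] := ht.
  have : effect_le (spec 1 0 u) (spec t 0 u).
    apply: mx; last by apply: spec_le.
    by apply/chainlikeP; exists 1, u; split.
  move=> /(le_spec_same (in01_1 R) (in01_0 R) ht (in01_0 R) hu) [h _].
  by congr spec; apply/eqP; rewrite eq_le h t1.
move=> [u hu ->]; split; first by apply/chainlikeP; exists 1, u; split.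
move=> B /chainlikeP [t [v [t0 ht hv ->]]].
move=> h; have [s hs e] := le_rank1_inv ht hv h.
have euv : u = v by apply: (@spec_rank1_inj _ 1 s) => //.
by rewrite euv; apply: spec_le => //; case: ht.
Qed.
End Symmetry.

(** * Harmonic means, and the images of projections and scalars *)

Section ShapeOfSymmetry.
Variable R : realType.
Local Notation vec := 'rV[R]_3.
Local Notation eff := (effect R 2).
Implicit Types (p a b c d s t x y : R) (u v : vec) (A B D : eff).

Let z01 := in01_0 R.
Let o01 := in01_1 R.

Lemma overlap_axes : overlap (axis3 R) (axis1 R) = 1 / 2.
Proof. by rewrite /overlap dot_axis1 mxE addr0. Qed.

(** For positive a and b, the harmonic mean of a and b with weights p and
    1 - p, as [hmeanV] states in its usual form. *)
Definition hmean (p a b : R) := a * b / (a * (1 - p) + b * p).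

Lemma overlap01 u v : unit_vec u -> unit_vec v -> in01 (overlap u v).
Proof.
move=> hu hv; have := Cauchy_Schwarz u v; rewrite hu hv mulr1 /overlap => h.
by split; nra.
Qed.

Lemma hmean_den p a b : in01 p -> 0 < a -> 0 < b -> 0 < a * (1 - p) + b * p.
Proof.
move=> [p0 p1] a0 b0; case: (lerP p (1/2)) => h.
  have : 0 < a * (1 - p) by apply: mulr_gt0 => //; lra.
  by have := mulr_ge0 (ltW b0) p0; lra.
have : 0 < b * p by apply: mulr_gt0 => //; lra.
have : 0 <= a * (1 - p) by apply: mulr_ge0; lra.
by lra.
Qed.

Lemma hmean01 p a b : in01 p -> in01 a -> in01 b -> 0 < a -> 0 < b ->
  in01 (hmean p a b).
Proof.
move=> hp [_ a1] [_ b1] a0 b0; have D := hmean_den hp a0 b0; case: hp => p0 p1.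
split; first by rewrite /hmean divr_ge0 ?mulr_ge0 // ltW.
rewrite /hmean ler_pdivrMr // mul1r.
have h1 : 0 <= a * (1 - p) * (1 - b) by rewrite !mulr_ge0 //; lra.
have h2 : 0 <= b * p * (1 - a) by rewrite !mulr_ge0 //; lra.
by nra.
Qed.

Lemma hmeanV p a b : in01 p -> 0 < a -> 0 < b ->
  (hmean p a b)^-1 = p / a + (1 - p) / b.
Proof.
move=> hp a0 b0; have D := hmean_den hp a0 b0; rewrite /hmean.
by field; rewrite !lt0r_neq0.
Qed.

Lemma le_rank1_hmean t a b u v : in01 t -> in01 a -> in01 b ->
  0 < a -> 0 < b -> unit_vec u -> unit_vec v ->
  effect_le (spec t 0 u) (spec a b v) <-> t <= hmean (overlap u v) a b.
Proof.
move=> ht ha hb a0 b0 hu hv; have hp := overlap01 hu hv.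
apply: iff_trans (le_rank1 ht ha hb hu hv) _.
move: (overlap u v) hp => p hp; have D := hmean_den hp a0 b0.
rewrite /hmean ler_pdivlMr //; split=> [[]//|h]; split=> //.
case: hp => p0 p1; have h2 : a * b <= (a + b) * (a * (1 - p) + b * p).
  have -> : (a + b) * (a * (1 - p) + b * p) = a * b + a * a * (1 - p) + b * b * p by ring.
  have q0 : 0 <= 1 - p by lra.
  by rewrite -addrA lerDl addr_ge0 ?mulr_ge0 // ltW.
by rewrite -(ler_pM2r D); apply: le_trans h2.
Qed.

Lemma inv1D_in01 x : 0 <= x -> in01 (1 + x)^-1 /\ 0 < (1 + x)^-1.
Proof.
move=> x0; have h : 0 < 1 + x by lra.
split; last by rewrite invr_gt0.
by split; [rewrite invr_ge0 ltW | rewrite invf_le1 // lerDl].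
Qed.

(** With eigenvalues 1 / (1 + x) and 1 / (1 + y) the criterion of
    [coexist_rank1] reads (1 + x) >= p (1 + y) / y + (1 - p) = 1 + p / y. *)
Lemma coexist_odds x y u v : 0 <= x -> 0 < y -> unit_vec u -> unit_vec v -> u != v ->
  coexistent (spec (1 + x)^-1 0 u) (spec (1 + y)^-1 0 v) <-> overlap u v <= x * y.
Proof.
move=> x0 y0 hu hv uv.
have [hs s0] := inv1D_in01 x0; have [ht t0] := inv1D_in01 (ltW y0).
have x1 : 0 < 1 + x by lra. have y1 : 0 < 1 + y by lra.
have a0 : 0 < 1 - (1 + y)^-1 by rewrite subr_gt0 invf_lt1 // ltrDl.
apply: iff_trans (coexist_rank1 hs ht hu hv uv) _.
apply: iff_trans (le_rank1_hmean hs (in01_compl ht) o01 a0 ltr01 hu hv) _.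
have hp := overlap01 hu hv; have := hmeanV hp a0 ltr01.
have : 0 < hmean (overlap u v) (1 - (1 + y)^-1) 1.
  by rewrite /hmean divr_gt0 ?mulr_gt0 ?hmean_den.
move: (hmean _ _ _) => q q0 eq.
rewrite -(lef_pV2 _ _) ?posrE ?invr_gt0 // invrK eq.
have -> : overlap u v / (1 - (1 + y)^-1) + (1 - overlap u v) / 1 = 1 + overlap u v / y.
  by field; rewrite !lt0r_neq0 //=; rewrite addrAC subrr add0r lt0r_neq0.
by rewrite lerD2l ler_pdivrMr.
Qed.

Lemma symmetry_proj phi : symmetry phi -> exists tau : vec -> vec, forall u, unit_vec u ->
  unit_vec (tau u) /\ phi (spec 1 0 u) = spec 1 0 (tau u).
Proof.
move=> Hphi.
have H u : exists u', unit_vec u -> unit_vec u' /\ phi (spec 1 0 u) = spec 1 0 u'.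
  have [hu|hu] := pselect (unit_vec u); last by exists 0.
  have h : max_chainlike (spec 1 0 u) by apply/max_chainlikeP; exists u.
  have /max_chainlikeP [u' hu' e] := symmetry_max_chainlike Hphi h.
  by exists u'.
by have [tau ht] := choice H; exists tau.
Qed.

Lemma symmetry_proj_surj phi u' : symmetry phi -> unit_vec u' ->
  exists2 u, unit_vec u & phi (spec 1 0 u) = spec 1 0 u'.
Proof.
move=> Hphi hu'; have [psi [hpsi K1 K2]] := symmetry_inv Hphi.
have h : max_chainlike (spec 1 0 u') by apply/max_chainlikeP; exists u'.
have /max_chainlikeP [u hu e] := symmetry_max_chainlike hpsi h.
by exists u => //; rewrite -e K2.
Qed.

(** By [coexist_proj], A commutes with all projections, hence is scalar.
    In this form the notion is invariant under symmetries once these are known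
    to permute the rank-one projections. *)
Definition scalar_effect A := forall u, unit_vec u -> coexistent A (spec 1 0 u).

(** It is enough to be diagonal along two different axes: the Bloch vector is
    then a multiple of two independent vectors. *)
Lemma scalar_effectP A : scalar_effect A <-> exists2 t, in01 t & A = spec t t (axis3 R).
Proof.
split=> [h|[t ht ->] u hu]; last first.
  by apply/coexist_proj => //; exists t, t; split=> //; exact: spec_scalar.
have [a [b [ha hb eA]]] := (coexist_proj A (unit_axis3 R)).1 (h _ (unit_axis3 R)).
have [c [d [hc hd eA']]] := (coexist_proj A (unit_axis1 R)).1 (h _ (unit_axis1 R)).
have := congr1 (@effect_op R 2) (etrans (esym eA) eA').
rewrite (effect_op_spec ha hb (unit_axis3 R)) (effect_op_spec hc hd (unit_axis1 R)).
move=> /bloch_inj [_ /rowP /(_ 2)]; rewrite !mxE /= => e.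
have eab : a = b by lra.
by exists a => //; rewrite eA eab.
Qed.

Lemma symmetry_scalar phi A : symmetry phi -> scalar_effect A -> scalar_effect (phi A).
Proof.
move=> hphi hA u' hu'; have [u hu <-] := symmetry_proj_surj hphi hu'.
by case: hphi => _ _ hco; apply: (hco _ _).1; exact: hA.
Qed.

Lemma symmetry_eigenvalue phi : symmetry phi -> exists g : R -> R, forall t, in01 t ->
  in01 (g t) /\ phi (spec t t (axis3 R)) = spec (g t) (g t) (axis3 R).
Proof.
move=> hphi.
have H t : exists t', in01 t ->
    in01 t' /\ phi (spec t t (axis3 R)) = spec t' t' (axis3 R).
  have [ht|ht] := pselect (in01 t); last by exists 0.
  have h : scalar_effect (spec t t (axis3 R)) by apply/scalar_effectP; exists t.
  have /scalar_effectP [t' ht' e] := symmetry_scalar hphi h.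
  by exists t'.
by have [g hg] := choice H; exists g.
Qed.

End ShapeOfSymmetry.

(** * The map on eigenvalues and on the Bloch sphere *)

Section Rigidity.
Variable R : realType.
Local Notation vec := 'rV[R]_3.
Local Notation eff := (effect R 2).
Implicit Types (p a b c d s t : R) (u v : vec) (A B D : eff).

Let z01 := in01_0 R.
Let o01 := in01_1 R.

Variables (phi : eff -> eff) (tau : vec -> vec) (g : R -> R).
Hypothesis Hphi : symmetry phi.
Hypothesis Htau : forall u, unit_vec u ->
  unit_vec (tau u) /\ phi (spec 1 0 u) = spec 1 0 (tau u).
Hypothesis Hg : forall t, in01 t ->
  in01 (g t) /\ phi (spec t t (axis3 R)) = spec (g t) (g t) (axis3 R).

Let Hle A B : effect_le A B <-> effect_le (phi A) (phi B).
Proof. by case: Hphi => _ h _; exact: h. Qed.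
Let Hco A B : coexistent A B <-> coexistent (phi A) (phi B).
Proof. by case: Hphi => _ _ h; exact: h. Qed.
Let Hinj : injective phi.
Proof. by case: Hphi => /bij_inj. Qed.

Let tau_unit u : unit_vec u -> unit_vec (tau u).
Proof. by move=> hu; case: (Htau hu). Qed.
Let phi_proj u : unit_vec u -> phi (spec 1 0 u) = spec 1 0 (tau u).
Proof. by move=> hu; case: (Htau hu). Qed.
Let g01 t : in01 t -> in01 (g t).
Proof. by move=> ht; case: (Hg ht). Qed.
Let phi_scalar t u v : in01 t -> phi (spec t t u) = spec (g t) (g t) v.
Proof.
by move=> ht; rewrite (spec_scalar t u (axis3 R)) (Hg ht).2; exact: spec_scalar.
Qed.

Let g_le s t : in01 s -> in01 t -> (s <= t <-> g s <= g t).
Proof.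
move=> hs ht; have hu := unit_axis3 R.
have h1 := le_spec_same hs hs ht ht hu.
have h2 := le_spec_same (g01 hs) (g01 hs) (g01 ht) (g01 ht) hu.
have h3 := Hle (spec s s (axis3 R)) (spec t t (axis3 R)).
rewrite (phi_scalar _ (axis3 R) hs) (phi_scalar _ (axis3 R) ht) in h3.
by split=> h; [apply: proj1 (h2.1 _); apply: h3.1; apply: h1.2
  | apply: proj1 (h1.1 _); apply: h3.2; apply: h2.2].
Qed.

Let g_surj s : in01 s -> exists2 t, in01 t & g t = s.
Proof.
move=> hs; have [psi [hpsi K1 K2]] := symmetry_inv Hphi.
have hA : scalar_effect (spec s s (axis3 R)) by apply/scalar_effectP; exists s.
have /scalar_effectP [t ht e] := symmetry_scalar hpsi hA.
exists t => //; have := K2 (spec s s (axis3 R)); rewrite e (phi_scalar _ (axis3 R) ht).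
by move=> /(spec_inj (g01 ht) (g01 ht) hs hs (unit_axis3 R)) [].
Qed.

(** Since g is an increasing bijection of [0,1], a value is determined by the
    elements of [0,1] above it, or below it in [g_upper]. *)
Let g_lower t f : in01 t -> in01 f -> (forall s, in01 s -> (t <= s <-> f <= g s)) ->
  f = g t.
Proof.
move=> ht hf h; have [s hs e] := g_surj hf.
have h1 := (h _ ht).1 (lexx _); apply/eqP; rewrite eq_le h1 -e /=.
by apply/(g_le ht hs).1/(h _ hs).2; rewrite e.
Qed.

Let g_upper t f : in01 t -> in01 f -> (forall s, in01 s -> (s <= t <-> g s <= f)) ->
  f = g t.
Proof.
move=> ht hf h; have [s hs e] := g_surj hf.
have h1 := (h _ ht).1 (lexx _); apply/eqP; rewrite eq_le h1 -e andbT.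
by apply/(g_le hs ht).1/(h _ hs).2; rewrite e.
Qed.

Let g0 : g 0 = 0.
Proof.
have [t ht e] := g_surj z01; apply/eqP; rewrite eq_le (g01 z01).1 andbT -{2}e.
by apply/(g_le z01 ht).1; case: ht.
Qed.

Let g_gt0 t : in01 t -> 0 < t -> 0 < g t.
Proof.
move=> ht t0; rewrite ltNge; apply/negP; rewrite -g0.
by move=> /(g_le ht z01).2; rewrite leNgt t0.
Qed.

(** P_(-u) commutes with P_u, so tau (- u) is tau u or - tau u, and
    injectivity excludes the former. *)
Let tauN u : unit_vec u -> tau (- u) = - tau u.
Proof.
move=> hu; have hNu := unit_vecN hu.
have : coexistent (phi (spec 1 0 (- u))) (phi (spec 1 0 u)).
  apply: (Hco _ _).1; apply/coexist_proj => //.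
  by exists 0, 1; rewrite specN.
rewrite !phi_proj // => /(coexist_proj _ (tau_unit hu)) [a [b [ha hb e]]].
have e' := congr1 (@effect_op R 2) e.
move: e'; rewrite (effect_op_spec o01 z01 (tau_unit hNu)).
rewrite (effect_op_spec ha hb (tau_unit hu)) => /bloch_inj [_ e'].
have e2 : tau (- u) = (a - b) *: tau u.
  apply: (@scalerI _ _ (1/2 : R)); first by apply: lt0r_neq0; lra.
  rewrite scalerA; move: e'; rewrite subr0 => ->; congr (_ *: _); lra.
have := tau_unit hNu; rewrite e2 /unit_vec.
have -> : dot ((a - b) *: tau u) ((a - b) *: tau u) = (a - b) ^+ 2 * dot (tau u) (tau u).
  by rewrite /dot !mxE; ring.
rewrite tau_unit // mulr1 => /eqP; rewrite sqrf_eq1 => /orP [] /eqP eab.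
  have : spec 1 0 (- u) = spec 1 0 u.
    by apply: Hinj; rewrite !phi_proj // e2 eab scale1r.
  by rewrite specN => /(spec_inj z01 o01 o01 z01 hu) [] /eqP; rewrite eq_sym oner_eq0.
by rewrite eab scaleN1r.
Qed.

(** The image lies below P_(tau u), so it is a multiple of it, and the factor
    is recovered from the scalar effects above t P_u. *)
Let phi_rank1 t u : in01 t -> unit_vec u -> phi (spec t 0 u) = spec (g t) 0 (tau u).
Proof.
move=> ht hu; have hu' := tau_unit hu.
have h : effect_le (spec t 0 u) (spec 1 0 u) by apply: spec_le => //; case: ht.
have := (Hle _ _).1 h; rewrite phi_proj // => /(le_rank1_inv o01 hu') [f hf e].
rewrite e; congr spec; apply: g_lower => // s hs.
have h1 := le_spec_same ht z01 hs hs hu.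
have h2 := le_spec_same hf z01 (g01 hs) (g01 hs) hu'.
have h3 := Hle (spec t 0 u) (spec s s u).
rewrite e (phi_scalar _ (tau u) hs) in h3.
have s0 : 0 <= s by case: hs.
have gs0 : 0 <= g s by case: (g01 hs).
split=> h4.
  by apply: proj1 (h2.1 _); apply: h3.1; apply: h1.2.
by apply: proj1 (h1.1 _); apply: h3.2; apply: h2.2.
Qed.

(** The eigenvalue along u is the largest s with s P_u below the effect. *)
Let phi_spec_fst a b a' b' u : in01 a -> in01 b -> in01 a' -> in01 b' -> unit_vec u ->
  phi (spec a b u) = spec a' b' (tau u) -> a' = g a.
Proof.
move=> ha hb ha' hb' hu e; have hu' := tau_unit hu.
apply: g_upper => // s hs.
have h1 := le_spec_same hs z01 ha hb hu.
have h2 := le_spec_same (g01 hs) z01 ha' hb' hu'.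
have h3 := Hle (spec s 0 u) (spec a b u).
rewrite e (phi_rank1 hs hu) in h3.
have b0 : 0 <= b by case: hb.
have b0' : 0 <= b' by case: hb'.
split=> h4.
  by apply: proj1 (h2.1 _); apply: h3.1; apply: h1.2.
by apply: proj1 (h1.1 _); apply: h3.2; apply: h2.2.
Qed.

Let phi_spec a b u : in01 a -> in01 b -> unit_vec u ->
  phi (spec a b u) = spec (g a) (g b) (tau u).
Proof.
move=> ha hb hu; have hu' := tau_unit hu.
have : coexistent (phi (spec a b u)) (phi (spec 1 0 u)).
  by apply: (Hco _ _).1; apply: (coexist_proj _ hu).2; exists a, b.
rewrite phi_proj // => /(coexist_proj _ hu') [a' [b' [ha' hb' e]]].
have ea := phi_spec_fst ha hb ha' hb' hu e.
have eb : b' = g b.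
  apply: (phi_spec_fst hb ha hb' ha' (unit_vecN hu)).
  by rewrite specN e tauN // specN.
by rewrite e ea eb.
Qed.

Let g_hmean a b u v : in01 a -> in01 b -> 0 < a -> 0 < b -> unit_vec u -> unit_vec v ->
  hmean (overlap (tau u) (tau v)) (g a) (g b) = g (hmean (overlap u v) a b).
Proof.
move=> ha hb a0 b0 hu hv.
have hu' := tau_unit hu; have hv' := tau_unit hv.
have ga0 := g_gt0 ha a0; have gb0 := g_gt0 hb b0.
apply: g_upper.
- by apply: hmean01 => //; exact: overlap01.
- by apply: hmean01 => //; [exact: overlap01|exact: g01|exact: g01].
move=> s hs.
have h1 := le_rank1_hmean hs ha hb a0 b0 hu hv.
have h2 := le_rank1_hmean (g01 hs) (g01 ha) (g01 hb) ga0 gb0 hu' hv'.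
have h3 := Hle (spec s 0 u) (spec a b v).
rewrite (phi_rank1 hs hu) (phi_spec ha hb hv) in h3.
by split=> h4; [apply: h2.1; apply: h3.1; apply: h1.2
  | apply: h1.1; apply: h3.2; apply: h2.2].
Qed.

(** The map induced by g in the coordinate x = 1 / t - 1 on eigenvalues, for
    which harmonic means of eigenvalues become arithmetic means. *)
Let odds x := (g (1 + x)^-1)^-1 - 1.

Let g_odds x : 0 <= x -> 0 < g (1 + x)^-1 /\ (g (1 + x)^-1)^-1 = 1 + odds x.
Proof.
by move=> /inv1D_in01 [h1 h2]; split; [exact: g_gt0 | rewrite /odds; lra].
Qed.

Let hmean_inv p x y : in01 p -> 0 <= x -> 0 <= y ->
  hmean p (1 + x)^-1 (1 + y)^-1 = (1 + (p * x + (1 - p) * y))^-1.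
Proof.
move=> hp x0 y0; have [_ h1] := inv1D_in01 x0; have [_ h2] := inv1D_in01 y0.
rewrite -[LHS]invrK hmeanV // !invrK; congr (_^-1); ring.
Qed.

Let odds_mean u v x y : unit_vec u -> unit_vec v -> 0 <= x -> 0 <= y ->
  odds (overlap u v * x + (1 - overlap u v) * y) =
  overlap (tau u) (tau v) * odds x + (1 - overlap (tau u) (tau v)) * odds y.
Proof.
move=> hu hv x0 y0.
have [a1 a2] := inv1D_in01 x0; have [b1 b2] := inv1D_in01 y0.
have hp := overlap01 hu hv; have hp' := overlap01 (tau_unit hu) (tau_unit hv).
have := g_hmean a1 b1 a2 b2 hu hv; rewrite hmean_inv // => e.
rewrite {1}/odds -e hmeanV //; [|exact: g_gt0|exact: g_gt0].
by rewrite (g_odds x0).2 (g_odds y0).2; ring.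
Qed.

Let g1 : g 1 = 1.
Proof.
have [t ht e] := g_surj o01; apply/eqP; rewrite eq_le (g01 o01).2 /= -{1}e.
by apply/(g_le ht o01).1; case: ht.
Qed.

Let odds0 : odds 0 = 0.
Proof. by rewrite /odds addr0 invr1 g1 invr1 subrr. Qed.

Let odds_le x y : 0 <= x -> 0 <= y -> (odds x <= odds y <-> x <= y).
Proof.
move=> x0 y0; have [a1 a2] := inv1D_in01 x0; have [b1 b2] := inv1D_in01 y0.
have [ga _] := g_odds x0; have [gb _] := g_odds y0.
rewrite /odds lerD2r lef_pV2 ?posrE //.
apply: iff_trans (iff_sym (g_le b1 a1)) _.
by rewrite lef_pV2 ?posrE ?lerD2l //; lra.
Qed.

(** [odds_mean] for two orthogonal axes has weights 1/2 and 1/2 on the left;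
    setting either argument to 0 evaluates the two terms on the right, which
    turns the identity into additivity. *)
Let odds_linear x : 0 <= x -> odds x = odds 1 * x.
Proof.
apply: additive_mono_linear => {x}.
  by move=> x y x0 xy; apply: (odds_le x0 (le_trans x0 xy)).2.
have H x y : 0 <= x -> 0 <= y -> odds (1 / 2 * x + (1 - 1 / 2) * y) =
    overlap (tau (axis3 R)) (tau (axis1 R)) * odds x
    + (1 - overlap (tau (axis3 R)) (tau (axis1 R))) * odds y.
  move=> x0 y0; rewrite -overlap_axes.
  by apply: odds_mean => //; [exact: unit_axis3|exact: unit_axis1].
move=> x y x0 y0.
have x2 : 0 <= 2 * x by lra. have y2 : 0 <= 2 * y by lra.
have := H _ _ x2 y2; have := H _ _ x2 (lexx 0); have := H _ _ (lexx 0) y2.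
rewrite odds0 !mulr0 !addr0 !add0r.
have -> : 1 / 2 * (2 * x) = x by field.
have -> : (1 - 1 / 2) * (2 * y) = y by field.
by move=> -> -> ->.
Qed.

Let odds1_gt0 : 0 < odds 1.
Proof.
rewrite ltNge -odds0; apply/negP => /(odds_le ler01 (lexx 0)).1.
by rewrite ler10.
Qed.

(** In [odds_mean], take x = 1 and y = 0 and use linearity. *)
Let tau_overlap u v : unit_vec u -> unit_vec v ->
  overlap (tau u) (tau v) = overlap u v.
Proof.
move=> hu hv; have := odds_mean hu hv ler01 (lexx 0).
rewrite odds0 !mulr0 !addr0 mulr1 odds_linear; last by case: (overlap01 hu hv).
by rewrite mulrC => /mulIf -> //; exact: lt0r_neq0.
Qed.

(** The criterion [coexist_odds] before and after phi, for projections of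
    overlap 1/2. *)
Let odds_cross x y : 0 <= x -> 0 < y ->
  (1 / 2 <= x * y <-> 1 / 2 <= odds x * odds y).
Proof.
move=> x0 y0; have hu := unit_axis3 R; have hv := unit_axis1 R.
have [a1 a2] := inv1D_in01 x0; have [b1 b2] := inv1D_in01 (ltW y0).
have ov := tau_overlap hu hv; rewrite overlap_axes in ov.
have ne : axis3 R != axis1 R.
  apply/eqP => e; have := overlap_axes R; rewrite e /overlap hv; lra.
have ne' : tau (axis3 R) != tau (axis1 R).
  apply/eqP => e; move: ov; rewrite e /overlap (tau_unit hv); lra.
have ox0 : 0 <= odds x by rewrite -odds0; apply: (odds_le (lexx 0) x0).2.
have oy0 : 0 < odds y.
  rewrite ltNge -odds0; apply/negP => /(odds_le (ltW y0) (lexx 0)).1.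
  by rewrite leNgt y0.
have := coexist_odds x0 y0 hu hv ne; rewrite overlap_axes => h1.
have := coexist_odds ox0 oy0 (tau_unit hu) (tau_unit hv) ne'; rewrite ov => h2.
have h3 := Hco (spec (1 + x)^-1 0 (axis3 R)) (spec (1 + y)^-1 0 (axis1 R)).
rewrite !phi_rank1 // in h3.
rewrite -(g_odds x0).2 -(g_odds (ltW y0)).2 !invrK in h2.
by apply: iff_trans (iff_sym h1) _; apply: iff_trans h3 h2.
Qed.

(** With c = [odds 1], [odds_cross] at y = 1 says that x >= 1/2 if and only if
    c^2 x >= 1/2. *)
Let odds1 : odds 1 = 1.
Proof.
have c0 := odds1_gt0.
have h x : 0 <= x -> (1 / 2 <= x <-> 1 / 2 <= odds 1 * odds 1 * x).
  move=> x0; have := odds_cross x0 ltr01; rewrite (odds_linear x0) mulr1.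
  by rewrite mulrAC.
have p0 : 0 <= 1 / 2 :> R by lra.
have h1 := (h _ p0).1 (lexx _).
have c1 : 1 <= odds 1 by nra.
have cc : 0 < odds 1 * odds 1 by rewrite mulr_gt0.
have q0 : 0 <= (1 / 2) / (odds 1 * odds 1) by rewrite divr_ge0 // ltW.
have := (h _ q0).2; rewrite [_ * _ * (_ / _)]mulrC divfK ?lt0r_neq0 // => /(_ (lexx _)).
by rewrite ler_pdivlMr // => h2; nra.
Qed.

Lemma symmetry_rotation :
  (forall u v, unit_vec u -> unit_vec v -> dot (tau u) (tau v) = dot u v) /\
  (forall a b u, in01 a -> in01 b -> unit_vec u -> phi (spec a b u) = spec a b (tau u)).
Proof.
split=> [u v hu hv|a b u ha hb hu].
  by have := tau_overlap hu hv; rewrite /overlap; lra.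
have gid t : in01 t -> g t = t.
  move=> [t0 t1]; have [->|nt] := eqVneq t 0; first exact: g0.
  have tp : 0 < t by rewrite lt_def nt.
  have x0 : 0 <= t^-1 - 1 by rewrite subr_ge0 invf_ge1.
  have := (g_odds x0).2; rewrite odds_linear // odds1 mul1r addrC subrK invrK.
  by move/invr_inj.
by rewrite phi_spec // !gid.
Qed.
End Rigidity.

(** * Conjugation by unitary and antiunitary operators *)

Section SemiUnitary.
Variables (R : realType) (n : nat).
Local Notation C := (R[i]%C).
Local Notation vecC := 'cV[C]_n.
Implicit Types (x y z : vecC) (A B : effect R n) (U Us : vecC -> vecC).

Lemma inner_conj x y : inner x y = (inner y x)^*.
Proof.
rewrite /inner !dotmxE !mxE rmorph_sum; apply: eq_bigr => i _.
by rewrite !mxE rmorphM /= conjCK mulrC.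
Qed.

Lemma inner_delta (M : 'M[C]_n) i j : inner (M *m delta_mx j 0) (delta_mx i 0) = M i j.
Proof.
rewrite -colE /inner dotmxE !mxE (bigD1 i) //= big1 ?addr0 => [|k ki].
  by rewrite !mxE !eqxx conjC1 mulr1.
by rewrite !mxE (negPf ki) conjC0 mulr0.
Qed.

Lemma mulmx_ext (M N : 'M[C]_n) : (forall x, M *m x = N *m x) -> M = N.
Proof. by move=> h; apply/matrixP => i j; rewrite -!inner_delta h. Qed.

Lemma linear_mx (f : vecC -> vecC) : linear f -> exists M : 'M[C]_n, forall x, M *m x = f x.
Proof.
move=> hf.
pose f' : {linear vecC -> vecC} := HB.pack f (GRing.isLinear.Build _ _ _ _ f hf).
exists (\matrix_(i, j) (f (delta_mx j 0)) i 0) => x.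
have -> : f x = f' (\sum_j x j 0 *: delta_mx j 0).
  rewrite {1}(matrix_sum_delta x); congr f.
  by apply: eq_bigr => i _; rewrite big_ord1.
apply/colP => i; rewrite linear_sum summxE mxE; apply: eq_bigr => j _.
by rewrite linearZ !mxE mulrC.
Qed.

Lemma inner_adjmx (M : 'M[C]_n) x y :
  inner (M *m x) y = inner x ((M ^t*)%sesqui *m y).
Proof.
rewrite /inner !dotmxE !mxE.
under eq_bigr do rewrite !mxE mulr_suml.
rewrite exchange_big; apply: eq_bigr => j _ /=.
rewrite !mxE rmorph_sum mulr_sumr; apply: eq_bigr => k _ /=.
by rewrite !mxE rmorphM /= conjCK mulrCA mulrA mulrAC.
Qed.

Lemma hermP (M : 'M[C]_n) :
  M \is hermsymmx <-> forall x y, inner (M *m x) y = inner x (M *m y).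
Proof.
split=> [/is_hermitianmxP|h].
  by rewrite expr0 scale1r => e x y; rewrite inner_adjmx -e.
apply/is_hermitianmxP; rewrite expr0 scale1r; apply/matrixP => i j.
by rewrite !mxE -!inner_delta h inner_conj.
Qed.

Lemma inner_map_conj x y :
  inner (map_mx Num.conj x) (map_mx Num.conj y) = (inner x y)^*.
Proof.
rewrite /inner !dotmxE !mxE rmorph_sum; apply: eq_bigr => i _ /=.
by rewrite !mxE rmorphM.
Qed.

Lemma map_conjK m k : involutive (map_mx Num.conj : 'M[C]_(m, k) -> _).
Proof. by move=> M; apply/matrixP => i j; rewrite !mxE conjCK. Qed.

Lemma unitary_op_mx (V : 'M[C]_n) : (V ^t*)%sesqui *m V = 1%:M ->
  unitary_op (fun x => V *m x) (fun x => (V ^t*)%sesqui *m x).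
Proof.
move=> h; split=> [a x y|x y|x|x].
- by rewrite mulmxDr -scalemxAr.
- exact: inner_adjmx.
- by rewrite mulmxA h mul1mx.
- by rewrite mulmxA (mulmx1C h) mul1mx.
Qed.

Lemma antiunitary_op_mx (V : 'M[C]_n) : (V ^t*)%sesqui *m V = 1%:M ->
  antiunitary_op (fun x => V *m map_mx Num.conj x)
                 (fun x => map_mx Num.conj ((V ^t*)%sesqui *m x)).
Proof.
move=> h; split=> [a x y|x y|x|x].
- by rewrite map_mxD map_mxZ mulmxDr -scalemxAr.
- by rewrite inner_adjmx -inner_map_conj map_conjK.
- by rewrite mulmxA h mul1mx map_conjK.
- by rewrite map_conjK mulmxA (mulmx1C h) mul1mx.
Qed.

(** The two cases of a standard automorphism at once: s is the identity for a
    unitary operator and complex conjugation for an antiunitary one. *)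
Definition semiunitary (s : C -> C) U Us : Prop :=
  [/\ forall a x y, U (a *: x + y) = s a *: U x + U y,
      forall x y, inner (U x) y = s (inner x (Us y)),
      cancel U Us & cancel Us U].

Definition conj_or_id (s : C -> C) : Prop := s = id \/ s = Num.conj.

Lemma semiunitaryP U Us : unitary_op U Us \/ antiunitary_op U Us ->
  exists2 s, conj_or_id s & semiunitary s U Us.
Proof.
move=> [[h1 h2 h3 h4]|[h1 h2 h3 h4]].
- by exists id; [left|split].
- by exists Num.conj; [right|split].
Qed.

Section Pair.
Variables (s : C -> C) (U Us : vecC -> vecC).
Hypotheses (hs : conj_or_id s) (hU : semiunitary s U Us).

Let sK : involutive s.
Proof. by case: hs => -> // a; rewrite conjCK. Qed.
Let s_conj a : s a^* = (s a)^*.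
Proof. by case: hs => ->. Qed.
Let s_le a b : (s a <= s b) = (a <= b).
Proof. by case: hs => -> //; rewrite -subr_ge0 -rmorphB conjC_ge0 subr_ge0. Qed.

Let UK : cancel U Us. Proof. by case: hU. Qed.
Let UsK : cancel Us U. Proof. by case: hU. Qed.
Let U_semilinear a x y : U (a *: x + y) = s a *: U x + U y.
Proof. by case: hU. Qed.
Let U_adj x y : inner (U x) y = s (inner x (Us y)).
Proof. by case: hU. Qed.

Lemma semiunitary_adj : semiunitary s Us U.
Proof.
split=> [a x y|x y||]; [| |exact: UsK|exact: UK].
  by rewrite -[RHS]UK U_semilinear sK !UsK.
by rewrite [in RHS]inner_conj U_adj -s_conj sK -inner_conj.
Qed.

Let Us_semilinear a x y : Us (a *: x + y) = s a *: Us x + Us y.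
Proof. by case: semiunitary_adj. Qed.
Let Us_adj x y : inner (Us x) y = s (inner x (U y)).
Proof. by case: semiunitary_adj. Qed.

Lemma inner_conj_by (M N : 'M[C]_n) x y : (forall x, N *m x = U (M *m Us x)) ->
  inner (N *m x) y = s (inner (M *m Us x) (Us y)).
Proof. by move=> ->; exact: U_adj. Qed.

Lemma le_op_conj_by (M N M' N' : 'M[C]_n) :
  (forall x, N *m x = U (M *m Us x)) -> (forall x, N' *m x = U (M' *m Us x)) ->
  le_op M M' <-> le_op N N'.
Proof.
move=> e e'; split=> h x.
  by rewrite (inner_conj_by _ _ e) (inner_conj_by _ _ e') s_le.
by have := h (U x); rewrite (inner_conj_by _ _ e) (inner_conj_by _ _ e') s_le UK.
Qed.

Let U_add x y : U (x + y) = U x + U y.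
Proof.
have := U_semilinear 1 x y; rewrite scale1r => ->.
have -> : s 1 = 1 by case: hs => -> //; exact: conjC1.
by rewrite scale1r.
Qed.

Let U0 : U 0 = 0.
Proof. by apply: (addrI (U 0)); rewrite -U_add !addr0. Qed.

(** The operator U A U^* is complex linear even when U is conjugate linear,
    so it is given by a matrix. *)
Lemma effect_conj_by A : exists B, forall x,
  effect_op B *m x = U (effect_op A *m Us x).
Proof.
have [N eN] : exists N : 'M[C]_n, forall x, N *m x = U (effect_op A *m Us x).
  apply: (@linear_mx (fun x => U (effect_op A *m Us x))) => a x y.
  by rewrite Us_semilinear mulmxDr -scalemxAr U_semilinear sK.
have [/hermP hA [A0 A1]] := effect_opP A.
suff hN : effects N.
  exists (mk_effect hN).
  exact: eN.
split; [apply/hermP|split].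
- by move=> x y; rewrite !eN U_adj hA Us_adj sK.
- by apply: (le_op_conj_by (M := 0) _ eN).1 A0 => x; rewrite !mul0mx U0.
- by apply: (le_op_conj_by eN _).1 A1 => x; rewrite !mul1mx UsK.
Qed.

Variable phi : effect R n -> effect R n.
Hypothesis hphi : forall A x, effect_op (phi A) *m x = U (effect_op A *m Us x).

Lemma effect_le_conj_by A B : effect_le A B <-> effect_le (phi A) (phi B).
Proof. exact: le_op_conj_by. Qed.

(** Conjugation by U is additive, so it carries a decomposition witnessing
    coexistence to another one. *)
Lemma coexistent_conj_by A B : coexistent A B -> coexistent (phi A) (phi B).
Proof.
move=> [E [F [G [eA eB eS]]]]; exists (phi E), (phi F), (phi G); split.
- by apply: mulmx_ext => x; rewrite mulmxDl !hphi eA mulmxDl U_add.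
- by apply: mulmx_ext => x; rewrite mulmxDl !hphi eB mulmxDl U_add.
pose X : effect R n := mk_effect eS.
suff <- : effect_op (phi X) = effect_op (phi E) + effect_op (phi F) + effect_op (phi G).
  exact: effect_opP.
by apply: mulmx_ext => x; rewrite !mulmxDl !hphi -!U_add -!mulmxDl.
Qed.
End Pair.

Lemma standard_automorphism_symmetry (phi : effect R n -> effect R n) :
  standard_automorphism phi ->
  (forall A B, effect_le A B <-> effect_le (phi A) (phi B)) /\
  (forall A B, coexistent A B <-> coexistent (phi A) (phi B)).
Proof.
move=> [U [Us [/semiunitaryP [s hs hU] hphi]]]; split=> A B.
  exact: (effect_le_conj_by hs hU hphi).
split; first exact: (coexistent_conj_by hs hU hphi).
have hUs := semiunitary_adj hs hU.
have [psi hpsi] := choice (effect_conj_by hs hUs).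
have K D : psi (phi D) = D.
  apply: effect_op_inj; apply: mulmx_ext => x; case: (hU) => _ _ UK _.
  by have := hpsi (phi D) x; rewrite hphi !UK.
by move=> h; rewrite -(K A) -(K B); exact: (coexistent_conj_by hs hUs hpsi h).
Qed.
End SemiUnitary.

(** * Orthogonal maps of the Bloch sphere come from (anti)unitary operators *)

Section Realization.
Variable R : realType.
Local Notation C := (R[i]%C).
Local Notation vec := 'rV[R]_3.
Implicit Types (u v : vec) (w : R).

Definition cross u v : vec := \row_i
  if i == 0 then u 0 1 * v 0 2 - u 0 2 * v 0 1 else
  if i == 1 then u 0 2 * v 0 0 - u 0 0 * v 0 2 else
  u 0 0 * v 0 1 - u 0 1 * v 0 0.

Definition orthonormal3 u1 u2 u3 : Prop :=
  [/\ unit_vec u1, unit_vec u2, unit_vec u3 &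
      [/\ dot u1 u2 = 0, dot u2 u3 = 0 & dot u1 u3 = 0]].

Lemma pauli_mul u v : bloch 0 u *m bloch 0 v =
  bloch (dot u v) 0 + (Complex 0 1 : C) *: bloch 0 (cross u v).
Proof.
by apply: mx2P; rewrite !mxE !sum2E !mxE /=; apply/eqP; rewrite eq_complex /=;
  apply/andP; split; apply/eqP; rewrite /dot; ring.
Qed.

(** The scalar e is the determinant of the frame; its square is the Gram
    determinant, which is 1. *)
Lemma cross_orthonormal u1 u2 u3 : orthonormal3 u1 u2 u3 ->
  exists2 e : R, e = 1 \/ e = -1 & u2 = e *: cross u3 u1.
Proof.
move=> [h1 h2 h3 [h12 h23 h13]].
pose e := dot u2 (cross u3 u1).
have ee : e ^+ 2 = 1.
  have -> : e ^+ 2 = dot u1 u1 * dot u2 u2 * dot u3 u3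
     + 2 * dot u1 u2 * dot u2 u3 * dot u1 u3 - dot u1 u1 * dot u2 u3 ^+ 2
     - dot u2 u2 * dot u1 u3 ^+ 2 - dot u3 u3 * dot u1 u2 ^+ 2.
    by rewrite /e /dot !mxE /=; ring.
  by rewrite h1 h2 h3 h12 h23 h13; ring.
exists e; first by move/eqP: ee; rewrite sqrf_eq1 => /orP [] /eqP; [left|right].
apply/eqP; rewrite -subr_eq0; apply/eqP/dot_eq0.
have -> : dot (u2 - e *: cross u3 u1) (u2 - e *: cross u3 u1) =
   dot u2 u2 - 2 * e * e + e ^+ 2 * (dot u1 u1 * dot u3 u3 - dot u1 u3 ^+ 2).
  by rewrite {4}/e /dot !mxE /=; ring.
by rewrite h1 h2 h3 h13 -mulrA -expr2 ee; ring.
Qed.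

(** By the equality case of Bessel's inequality: v minus its orthogonal
    projection has squared length v.v - x^2 - y^2 - z^2. *)
Lemma orthonormal_expansion u1 u2 u3 v (x y z : R) : orthonormal3 u1 u2 u3 ->
  dot v u1 = x -> dot v u2 = y -> dot v u3 = z ->
  dot v v = x ^+ 2 + y ^+ 2 + z ^+ 2 -> v = x *: u1 + y *: u2 + z *: u3.
Proof.
move=> [h1 h2 h3 [h12 h23 h13]] e1 e2 e3 e.
apply/eqP; rewrite -subr_eq0; apply/eqP/dot_eq0; move: e.
set w := x *: u1 + y *: u2 + z *: u3.
have -> : dot (v - w) (v - w) = dot v v
    - 2 * (x * dot v u1 + y * dot v u2 + z * dot v u3)
    + (x ^+ 2 * dot u1 u1 + y ^+ 2 * dot u2 u2 + z ^+ 2 * dot u3 u3)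
    + 2 * (x * y * dot u1 u2 + y * z * dot u2 u3 + x * z * dot u1 u3).
  by rewrite /w /dot !mxE; ring.
by rewrite e1 e2 e3 h1 h2 h3 h12 h23 h13 => ->; ring.
Qed.

Lemma pauli_eigenvector u : unit_vec u ->
  exists2 q : 'cV[C]_2, bloch 0 u *m q = q & inner q q = 1.
Proof.
rewrite /unit_vec /dot => hu.
have [e|ne] := eqVneq (u 0 2) (- 1).
  have z (t s : R) : t ^+ 2 + s ^+ 2 = 0 -> t = 0.
    by move=> h; have := sqr_ge0 t; have := sqr_ge0 s => h1 h2;
      apply/eqP; rewrite -sqrf_eq0; apply/eqP; lra.
  have e0 : u 0 0 = 0 by apply: (z _ (u 0 1)); rewrite e in hu; lra.
  have e1 : u 0 1 = 0 by apply: (z _ (u 0 0)); rewrite e in hu; lra.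
  exists (\col_i if i == 0 then 0 else 1); last first.
    by rewrite innerE !mxE /= conjC0 conjC1 mulr0 add0r mulr1.
  apply/colP => i; rewrite !mxE !sum2E !mxE /=.
  by case: ifP => _ /=; rewrite e0 e1 e; apply/eqP; rewrite eq_complex /=;
    apply/andP; split; apply/eqP; ring.
pose s := Num.sqrt (2 + 2 * u 0 2).
have c0 : 0 < 2 + 2 * u 0 2.
  have h : -1 <= u 0 2 by have := sqr_ge0 (u 0 0); have := sqr_ge0 (u 0 1); nra.
  have : -1 < u 0 2 by rewrite lt_neqAle h eq_sym ne.
  by lra.
have s0 : 0 < s by rewrite sqrtr_gt0.
have ss : s ^+ 2 = 2 + 2 * u 0 2 by rewrite sqr_sqrtr // ltW.
have sn : s != 0 by rewrite lt0r_neq0.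
(* The normalized first column of 1 + u.sigma; it vanishes only for
   u = (0, 0, -1), the case treated above. *)
exists (\col_i if i == 0 then Complex ((1 + u 0 2) / s) 0
               else Complex (u 0 0 / s) (u 0 1 / s)).
  apply/colP => i; rewrite !mxE !sum2E !mxE /=.
  case: ifP => _ /=; apply/eqP; rewrite eq_complex /=; apply/andP; split; apply/eqP; try ring.
  apply/eqP; rewrite -subr_eq0.
  rewrite [X in X == 0](_ : _ =
    (u 0 0 * u 0 0 + u 0 1 * u 0 1 + u 0 2 * u 0 2 - 1) / s); last by ring.
  by rewrite hu subrr mul0r.
rewrite innerE !mxE /=; apply/eqP; rewrite eq_complex /=; apply/andP; split; apply/eqP; last by ring.
have -> : (1 + u 0 2) / s * ((1 + u 0 2) / s) - 0 * - 0 +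
  (u 0 0 / s * (u 0 0 / s) - u 0 1 / s * - (u 0 1 / s)) =
  (1 + 2 * u 0 2 + (u 0 0 * u 0 0 + u 0 1 * u 0 1 + u 0 2 * u 0 2)) / s ^+ 2.
  by field.
by rewrite hu ss; field; rewrite lt0r_neq0.
Qed.

Lemma bloch_expand w (a b c : R) u1 u2 u3 :
  bloch w (a *: u1 + b *: u2 + c *: u3) = (Complex w 0)%:M +
    Complex a 0 *: bloch 0 u1 + Complex b 0 *: bloch 0 u2 + Complex c 0 *: bloch 0 u3.
Proof.
by apply: mx2P; rewrite !mxE /=; apply/eqP; rewrite eq_complex /=;
  apply/andP; split; apply/eqP; ring.
Qed.

Lemma pauli_sqr u : unit_vec u -> bloch 0 u *m bloch 0 u = 1%:M.
Proof.
move=> hu; rewrite pauli_mul hu -bloch1.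
by apply: mx2P; rewrite !mxE /=; apply/eqP; rewrite eq_complex /=;
  apply/andP; split; apply/eqP; ring.
Qed.

Lemma pauli_anticomm u v : dot u v = 0 ->
  bloch 0 u *m bloch 0 v = - (bloch 0 v *m bloch 0 u).
Proof.
move=> h; have h' : dot v u = 0 by rewrite -h /dot; ring.
rewrite !pauli_mul h h'.
by apply: mx2P; rewrite !mxE /=; apply/eqP; rewrite eq_complex /=;
  apply/andP; split; apply/eqP; ring.
Qed.

(** For orthogonal u and v, (u.sigma)(v.sigma) = i (u x v).sigma. *)
Lemma pauli_cross (e : R) u v : dot u v = 0 ->
  bloch 0 (e *: cross u v) = Complex 0 (- e) *: (bloch 0 u *m bloch 0 v).
Proof.
move=> h; rewrite pauli_mul h.
by apply: mx2P; rewrite !mxE /=; apply/eqP; rewrite eq_complex /=;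
  apply/andP; split; apply/eqP; ring.
Qed.

(** For e = -1, entrywise conjugation acts in this way on Bloch vectors, since the second Pauli matrix is the only imaginary one. *)
Definition reflect2 (e : R) v : vec := \row_i if i == 1 then e * v 0 i else v 0 i.

(** The Pauli matrices S1, S2, S3 of the frame satisfy the relations of the
    standard ones, up to the sign e of S2.  In the basis of a unit eigenvector q
    of S3 and of r = S1 q, anticommutation gives S3 r = - r, so q and r are
    orthogonal and S1, S2, S3 act by the standard Pauli matrices up to that
    sign. *)
Lemma pauli_frame u1 u2 u3 : orthonormal3 u1 u2 u3 ->
  exists V : 'M[C]_2, (V ^t*)%sesqui *m V = 1%:M /\
  exists2 e : R, e = 1 \/ e = -1 & forall w v,
    bloch w (v 0 0 *: u1 + v 0 1 *: u2 + v 0 2 *: u3) *m V = V *m bloch w (reflect2 e v).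
Proof.
move=> ho; have [e he eu2] := cross_orthonormal ho.
case: ho => h1 h2 h3 [h12 h23 h13].
have h31 : dot u3 u1 = 0 by rewrite -h13 /dot; ring.
have [q hq qq] := pauli_eigenvector h3.
have [r S1q] : exists r, bloch 0 u1 *m q = r by exists (bloch 0 u1 *m q).
have S1r : bloch 0 u1 *m r = q by rewrite -S1q mulmxA pauli_sqr // mul1mx.
have S3r : bloch 0 u3 *m r = - r.
  by rewrite -S1q mulmxA pauli_anticomm // mulNmx -mulmxA hq S1q.
have S2q : bloch 0 u2 *m q = Complex 0 (- e) *: - r.
  by rewrite eu2 pauli_cross // -scalemxAl -mulmxA S1q S3r.
have S2r : bloch 0 u2 *m r = Complex 0 (- e) *: q.
  by rewrite eu2 pauli_cross // -scalemxAl -mulmxA S1r hq.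
have herm u x y : inner (bloch 0 u *m x) y = inner x (bloch 0 u *m y).
  by move/hermP: (bloch_herm 0 u); exact.
have rr : inner r r = 1 by have := herm u1 q r; rewrite S1q S1r qq.
have innerN (x y : 'cV[C]_2) : inner x (- y) = - inner x y.
  by rewrite !innerE !mxE !rmorphN /= !mulrN opprD.
have qr : inner q r = 0.
  have := herm u3 q r; rewrite hq S3r innerN => /eqP.
  by rewrite -addr_eq0 -mulr2n mulrn_eq0 /= => /eqP.
have rq : inner r q = 0 by rewrite inner_conj qr conjC0.
pose V : 'M[C]_2 := \matrix_(i, j) if j == 0 then q i 0 else r i 0.
exists V; split.
  have gram i j : ((V ^t*)%sesqui *m V) i j = inner (col j V) (col i V).
    by rewrite mxE sum2E innerE !mxE [X in X + _]mulrC [X in _ + X]mulrC.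
  have c0 : col 0 V = q by apply/colP => i; rewrite !mxE.
  have c1 : col 1 V = r by apply/colP => i; rewrite !mxE.
  by apply: mx2P; rewrite gram ?c0 ?c1 ?qq ?qr ?rq ?rr mxE.
exists e => // w v; rewrite bloch_expand.
set M := (X in X *m V); set N := bloch w (reflect2 e v).
have colL j : col j (M *m V) = M *m (if j == 0 then q else r).
  apply/colP => i; rewrite mxE [LHS]mxE [RHS]mxE; apply: eq_bigr => k _.
  by congr (_ * _); rewrite mxE; case: ifP.
have colR j : col j (V *m N) = N 0 j *: q + N 1 j *: r.
  by apply/colP => i; rewrite !mxE sum2E !mxE /=; congr (_ + _); exact: mulrC.
suff colE j : col j (M *m V) = col j (V *m N).
  by apply/matrixP => i j; have /colP /(_ i) := colE j; rewrite !mxE.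
rewrite colL colR /M !mulmxDl -!scalemxAl mul_scalar_mx.
have [|] := eqVneq j 0.
  move=> ->; rewrite S2q hq S1q /N.
  apply/colP => i; rewrite !mxE /=; case: (q i 0) => q1 q2; case: (r i 0) => r1 r2.
  by apply/eqP; rewrite eq_complex /=; apply/andP; split; apply/eqP; ring.
case: j => [[|[|//]] hj] // _; rewrite (_ : Ordinal hj = 1); last exact: val_inj.
rewrite S1r S2r S3r /N.
apply/colP => i; rewrite !mxE /=; case: (q i 0) => q1 q2; case: (r i 0) => r1 r2.
by apply/eqP; rewrite eq_complex /=; apply/andP; split; apply/eqP; ring.
Qed.

(** Since tau preserves scalar products, the coordinates of tau u in the frame
    of the images of the axes are those of u, so [pauli_frame] intertwines A and
    phi A. *)
Lemma rotation_standard (phi : effect R 2 -> effect R 2) (tau : vec -> vec) :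
  (forall u, unit_vec u -> unit_vec (tau u)) ->
  (forall u v, unit_vec u -> unit_vec v -> dot (tau u) (tau v) = dot u v) ->
  (forall a b u, in01 a -> in01 b -> unit_vec u ->
     phi (spec a b u) = spec a b (tau u)) ->
  standard_automorphism phi.
Proof.
move=> tau_unit tau_dot hphi.
have he1 := unit_axis1 R; have he2 := unit_axis2 R; have he3 := unit_axis3 R.
have ho : orthonormal3 (tau (axis1 R)) (tau (axis2 R)) (tau (axis3 R)).
  split; [exact: tau_unit|exact: tau_unit|exact: tau_unit|].
  by rewrite !tau_dot // dot_axis2 !dot_axis3 !mxE.
have [V [VV [e he frame]]] := pauli_frame ho.
have tauE u : unit_vec u ->
    tau u = u 0 0 *: tau (axis1 R) + u 0 1 *: tau (axis2 R) + u 0 2 *: tau (axis3 R).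
  by move=> hu; apply: (orthonormal_expansion ho); rewrite tau_dot //;
    rewrite ?dot_axis1 ?dot_axis2 ?dot_axis3 // /dot !expr2.
have key a b u : unit_vec u ->
    spec_mx a b (tau u) *m V = V *m bloch ((a + b) / 2) (reflect2 e ((a - b) / 2 *: u)).
  move=> hu; rewrite -frame; congr (bloch _ _ *m _).
  by rewrite {1}tauE // !scalerDr !scalerA !mxE.
have phiE A (x : 'cV[C]_2) : exists w v, effect_op A = bloch w v /\
   effect_op (phi A) *m x = V *m (bloch w (reflect2 e v) *m ((V ^t*)%sesqui *m x)).
  have [a [b [u [ha hb hu ->]]]] := specP A.
  exists ((a + b) / 2), ((a - b) / 2 *: u); rewrite hphi //.
  rewrite (effect_op_spec ha hb hu) (effect_op_spec ha hb (tau_unit _ hu)).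
  split; first by [].
  by rewrite mulmxA -(key _ _ _ hu) -mulmxA [V *m _]mulmxA (mulmx1C VV) mul1mx.
case: he => ee.
  exists (fun x => V *m x), (fun x => (V ^t*)%sesqui *m x).
  split; first by left; exact: unitary_op_mx.
  move=> A x; have [w [v [-> ->]]] := phiE A x; congr (_ *m (bloch _ _ *m _)).
  by apply/rowP => i; rewrite ee !mxE mul1r; case: ifP.
exists (fun x => V *m map_mx Num.conj x), (fun x => map_mx Num.conj ((V ^t*)%sesqui *m x)).
split; first by right; exact: antiunitary_op_mx.
move=> A x; have [w [v [-> ->]]] := phiE A x.
rewrite map_mxM map_conjK; congr (_ *m (_ *m _)).
have conjE (a b : R) : (Complex a b)^* = Complex a (- b) by [].
by apply: mx2P; rewrite !mxE /= conjE ?ee ?mulN1r ?oppr0 ?opprK.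
Qed.
End Realization.

Theorem theorem1p2 (R : realType) (phi : effect R 2 -> effect R 2) :
  (bijective phi ->
   (forall A B : effect R 2, effect_le A B <-> effect_le (phi A) (phi B)) ->
   (forall A B : effect R 2, coexistent A B <-> coexistent (phi A) (phi B)) ->
   standard_automorphism phi)
  /\
  (standard_automorphism phi ->
   (forall A B : effect R 2, effect_le A B <-> effect_le (phi A) (phi B)) /\
   (forall A B : effect R 2, coexistent A B <-> coexistent (phi A) (phi B))).
Proof.
split=> [hbij hle hco|]; last exact: standard_automorphism_symmetry.
have hphi : symmetry phi by split.
have [tau htau] := symmetry_proj hphi.
have [g hg] := symmetry_eigenvalue hphi.
have [tau_dot phiE] := symmetry_rotation hphi htau hg.
apply: rotation_standard tau_dot phiE => u hu.
by case: (htau u hu).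
Qed.
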